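(* Suppose that the $L^2$-projection $Q_h:V\to V_h$ satisfies, for all $v\in V$, $$|Q_hv|_a^2\le c_1|v|_a^2,\qquad \|v-Q_hv\|_0^2\le c_2h^2|v|_a^2,$$ with constants $c_1,c_2>0$ independent of $h$ and $v$. Then for every $k$ such that $$\lambda_k<\frac{1}{2c_2h^2},$$ the following error estimate holds: $$0\le\sqrt{\lambda_{h,k}}-\sqrt{\lambda_k}\le C\sup_{w\in W_k,\ \|w\|_0=1}|(I-Q_h)w|_a,$$ where $C=1+\frac{c_1}{2}$, which is independent of $k$ and $h$.
   Context: Let $d\in\{1,2,3\}$ and let $\Omega\subset\mathbb R^d$ be a bounded domain with Lipschitz boundary. Consider $\mathcal L u=-\nabla\cdot(\alpha(x)\nabla u)+q(x)u$ on $\Omega$, where $\alpha$ is a function on $\Omega$ with values in the symmetric positive definite $d\times d$ real matrices satisfying $\alpha_0\|\xi\|^2\le\xi^T\alpha(x)\xi\le\alpha_1\|\xi\|^2$ for all $\xi\in\mathbb R^d$ and $x\in\Omega$, with positive constants $\alpha_0,\alpha_1$, and $q$ is bounded and nonnegative almost everywhere in $\Omega$. The space $V$ is determined by the boundary conditions: $V=H^1(\Omega)$, or $V=H^1_D(\Omega)=\{v\in H^1(\Omega):v|_{\Gamma_D}=0\}$ with $\Gamma_D\subset\partial\Omega$ (in particular $V=H^1_0(\Omega)$ when $\Gamma_D=\partial\Omega$). The bilinear form is $$a(u,v)=\int_\Omega(\alpha\nabla u)\cdot\nabla v+\int_\Omega q\,uv,\quad u,v\in V,$$ with $(u,v)=\int_\Omega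 uv$, $\|v\|_0^2=(v,v)$ and $|v|_a^2=a(v,v)$ (a norm or seminorm on $V$). Let $0\le\lambda_1\le\lambda_2\le\cdots$ be the eigenvalues (with multiplicity) of $\mathcal L$, with corresponding eigenfunctions $\varphi_1,\varphi_2,\ldots\in V$ orthonormal in $L^2(\Omega)$, understood weakly: $a(\varphi_k,v)=\lambda_k(\varphi_k,v)$ for all $v\in V$. Put $W_k=\operatorname{span}\{\varphi_1,\ldots,\varphi_k\}$. Let $\mathcal T_h$ be a triangulation of $\Omega$ into simplices with $h=\max_{T\in\mathcal T_h}\operatorname{diam}(T)$, and let $V_h\subset V$ be a finite element space of dimension $N$ consisting of piecewise linear (or higher order) polynomials with respect to $\mathcal T_h$. Let $\lambda_{h,1}\le\cdots\le\lambda_{h,N}$ be the eigenvalues (with multiplicity) of the operator $\mathcal L_h:V_h\to V_h$ defined by $(\mathcal L_hu,v)=a(u,v)$ for all $u,v\in V_h$. The $L^2$-projection $Q_h:V\to V_h$ is defined by $(Q_hv,w)=(v,w)$ for all $v\in V$, $w\in V_h$. *)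

(* Defs.v *)
From HB Require Import structures.
From mathcomp Require Export all_boot all_order all_algebra.
From mathcomp Require Export all_classical all_reals all_analysis.
Export Order.TTheory GRing.Theory Num.Theory numFieldNormedType.Exports.

Set Implicit Arguments.
Unset Strict Implicit.
Unset Printing Implicit Defensive.

Local Open Scope classical_set_scope.
Local Open Scope ring_scope.

(* The ambient space R^d is 'rV[R]_n.+1, that is, d = n.+1.  Its MathComp norm
   is the sup norm (same topology); Euclidean lengths are [enorm]. *)

Section euclidean.
Context {R : realType} {n : nat}.
Local Notation Rd := 'rV[R]_n.+1.

Definition dotv (x y : Rd) : R := (x *m y^T) 0 0.

Definition enorm (x : Rd) : R := Num.sqrt (dotv x x).

Definition ediam (A : set Rd) : \bar R :=
  ereal_sup [set (enorm (xy.1 - xy.2))%:E | xy in A `*` A].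

Definition diam (A : set Rd) : R := fine (ediam A).

Definition boundary (A : set Rd) : set Rd := closure A `\` A°.

End euclidean.

(* Method I outer measures: the library's [mu_ext] takes covers in a semiring
   of sets; declaring all sets to be members lets [tau] alone select the
   admissible covering sets (it is +oo on the others). *)
Section method_one.
Context {R : realType} {T : pointedType}.
Implicit Types tau : set T -> \bar R.

Definition cover_outer tau (A : set T) : \bar R :=
  @mu_ext _ (g_sigma_algebraType [set: set T]) R tau A.

Lemma cover_outer_isOuter tau : tau set0 = 0%E -> (forall A, 0 <= tau A)%E ->
  isOuterMeasure R T (cover_outer tau).
Proof.
pose S : semiRingOfSetsType _ := g_sigma_algebraType [set: set T].
move=> tau0 tau_ge0; split.
- exact: (@mu_ext0 _ S R tau tau0 tau_ge0).
- exact: (@mu_ext_ge0 _ S R tau tau_ge0).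
- exact: (@le_mu_ext _ S R tau).
- exact: (@mu_ext_sigma_subadditive _ S R tau tau_ge0).
Qed.

End method_one.

Section lebesgue.
Context (R : realType) (n : nat).
Local Notation Rd := 'rV[R]_n.+1.

Definition box (ab : Rd * Rd) : set Rd :=
  [set x | forall i, ab.1 0 i <= x 0 i <= ab.2 0 i].

Definition box_vol (ab : Rd * Rd) : R :=
  \prod_(i < n.+1) Num.max 0 (ab.2 0 i - ab.1 0 i).

(* The volume of a closed box, and +oo (infimum of the empty set) on a set
   which is not a closed box. *)
Definition vol (A : set Rd) : \bar R :=
  ereal_inf [set (box_vol ab)%:E | ab in [set ab | box ab = A]].

Definition leb_star : set Rd -> \bar R := cover_outer vol.

Lemma vol_ge0 A : (0 <= vol A)%E.
Proof.
apply: le_ereal_inf_tmp => _ [ab _ <-]; rewrite lee_fin.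
by apply: prodr_ge0 => i _; rewrite le_max lexx.
Qed.

Lemma vol0 : vol set0 = 0%E.
Proof.
apply/eqP; rewrite eq_le vol_ge0 andbT; apply: ereal_inf_lbound.
exists (0, const_mx (-1)).
  rewrite /= -subset0 => x /(_ ord0); rewrite !mxE => /andP[x0 xN1].
  by have := le_trans x0 xN1; rewrite lerNr oppr0 ler10.
by rewrite /box_vol (bigD1 ord0)//= !mxE subr0 max_l ?mul0r// lerN10.
Qed.

Lemma leb_star_isOuter : isOuterMeasure R Rd leb_star.
Proof. exact: cover_outer_isOuter vol0 vol_ge0. Qed.

HB.instance Definition _ := leb_star_isOuter.

Definition leb_outer : {outer_measure set Rd -> \bar R} := leb_star.

(* Lebesgue measure on R^d, on the sigma-algebra of Lebesgue (Caratheodory)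
   measurable sets. *)
Definition leb :
    {measure set (caratheodory_type leb_outer) -> \bar R} :=
  (leb_outer : set (caratheodory_type leb_outer) -> \bar R).

End lebesgue.

Section hausdorff.
Context (R : realType) (n : nat).
Local Notation Rd := 'rV[R]_n.+1.

Definition hgauge (s : nat) (delta : R) (A : set Rd) : \bar R :=
  if A == set0 then 0%E
  else if (ediam A <= delta%:E)%E then (ediam A ^+ s)%E else +oo%E.

(* The s-dimensional Hausdorff measure, up to the usual normalizing factor
   (counting measure for s = 0). *)
Definition hausdorff_star (s : nat) (A : set Rd) : \bar R :=
  ereal_sup [set cover_outer (hgauge s delta) A | delta in [set d : R | 0 < d]].

Lemma ediam_ge0 (A : set Rd) : A != set0 -> (0 <= ediam A)%E.
Proof.
case/set0P => x Ax; apply: ereal_sup_ubound; exists (x, x) => //=.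
rewrite subrr /enorm /dotv mul0mx mxE.
by rewrite sqrtr0.
Qed.

Lemma hgauge0 s delta : hgauge s delta set0 = 0%E.
Proof. by rewrite /hgauge eqxx. Qed.

Lemma hgauge_ge0 s delta A : (0 <= hgauge s delta A)%E.
Proof.
rewrite /hgauge; case: ifPn => // A0; case: ifPn => _; last exact: leey.
by apply: expe_ge0; exact: ediam_ge0.
Qed.

Lemma hausdorff_star_isOuter s : isOuterMeasure R Rd (hausdorff_star s).
Proof.
have H delta := cover_outer_isOuter (hgauge0 s delta) (@hgauge_ge0 s delta).
have ge0 A : (0 <= hausdorff_star s A)%E.
  apply: (@le_trans _ _ (cover_outer (hgauge s 1) A)).
    by case: (H 1) => _ + _ _; apply.
  by apply: ereal_sup_ubound; exists 1 => //=; exact: ltr01.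
split => //.
- apply/eqP; rewrite eq_le ge0 andbT; apply: ge_ereal_sup => _ [delta _ <-].
  by case: (H delta) => ->.
- move=> A B AB; apply: ge_ereal_sup => _ [delta d0 <-].
  apply: (@le_trans _ _ (cover_outer (hgauge s delta) B)).
    by case: (H delta) => _ _ + _; apply.
  by apply: ereal_sup_ubound; exists delta.
- move=> F; apply: ge_ereal_sup => _ [delta d0 <-].
  apply: (@le_trans _ _ (\sum_(i <oo) cover_outer (hgauge s delta) (F i))%E).
    by case: (H delta) => _ _ _; apply.
  apply: lee_nneseries => [i _ _|i _].
    by case: (H delta) => _ + _ _; apply.
  by apply: ereal_sup_ubound; exists delta.
Qed.

HB.instance Definition _ s := hausdorff_star_isOuter s.

Definition hausdorff_outer (s : nat) : {outer_measure set Rd -> \bar R} :=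
  hausdorff_star s.

(* Surface measure: the (d-1)-dimensional Hausdorff measure, d = n.+1. *)
Definition surf :
    {measure set (caratheodory_type (hausdorff_outer n)) -> \bar R} :=
  (hausdorff_outer n : set (caratheodory_type (hausdorff_outer n)) -> \bar R).

End hausdorff.


Section domains.
Context {R : realType} {n : nat}.
Local Notation Rd := 'rV[R]_n.+1.

Definition is_domain (Om : set Rd) : Prop :=
  [/\ Om !=set0, open Om & connected Om].

(* Near each boundary point, in a suitable orthonormal frame [O], the domain is
   the open epigraph of a Lipschitz function of the last d - 1 coordinates. *)
Definition lipschitz_boundary (Om : set Rd) : Prop :=
  forall x, boundary Om x ->
  exists (O : 'M[R]_n.+1) (gam : 'rV[R]_n -> R) (L : R),
  [/\ O *m O^T = 1%:M,
      forall y z, `|gam y - gam z| <= L * `|y - z| &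
      \forall y \near x,
        Om y <-> gam (col' ord0 (y *m O)) < (y *m O) 0 ord0].

End domains.

Section sobolev.
Context {R : realType} {n : nat}.
Local Notation Rd := 'rV[R]_n.+1.
Local Notation Leb := (caratheodory_type (leb_outer R n)).
Implicit Types (Om GD : set Rd) (f : Rd -> R) (g : Rd -> Rd).

Definition basis_vec (i : 'I_n.+1) : Rd := delta_mx 0 i.

Fixpoint Ck (k : nat) f : Prop :=
  continuous f /\
  if k is k'.+1 then forall i,
    (forall x, derivable f x (basis_vec i)) /\ Ck k' ('D_(basis_vec i) f)
  else True.

Definition smooth f : Prop := forall k, Ck k f.

Definition test_function Om f : Prop :=
  [/\ smooth f, compact (closure [set x | f x != 0]) &
      closure [set x | f x != 0] `<=` Om].

Definition classical_grad f : Rd -> Rd :=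
  fun x => \row_i 'D_(basis_vec i) f x.

Definition ae_on Om (P : Rd -> Prop) : Prop :=
  {ae leb R n, forall x, Om x -> P x}.

Definition lmeasurable_fun Om f : Prop :=
  measurable_fun (Om : set Leb) (f : Leb -> R).

Definition integral_on Om f : R := \int[leb R n]_(x in Om) f x.

Definition L2 Om f : Prop :=
  lmeasurable_fun Om f /\
  (leb R n).-integrable Om (fun x => ((f x) ^+ 2)%:E).

Definition weak_grad Om f g : Prop :=
  forall (phi : Rd -> R) (i : 'I_n.+1), test_function Om phi ->
  integral_on Om (fun x => f x * 'D_(basis_vec i) phi x) =
  - integral_on Om (fun x => g x 0 i * phi x).

(* An element of H^1 is represented by a pair (u, grad u) of a function and its
   weak gradient, so that H^1 sits inside this vector space.  Both components
   are genuine functions; equality in L^2 is equality a.e. ([ae_on]). *)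
Definition fgrad : lmodType R := ((Rd -> R) * (Rd -> Rd))%type.

Definition H1 Om : set fgrad :=
  [set u : fgrad | [/\ L2 Om u.1, forall i, L2 Om (fun x => u.2 x 0 i) &
               weak_grad Om u.1 u.2]].

Definition H1_cvg Om (w : nat -> Rd -> R) (u : fgrad) : Prop :=
  (fun m => \int[leb R n]_(x in Om) (((w m x - u.1 x) ^+ 2)%R)%:E)%E @ \oo
    --> 0%E /\
  (fun m => \int[leb R n]_(x in Om)
     ((enorm (classical_grad (w m) x - u.2 x) ^+ 2)%R)%:E)%E @ \oo --> 0%E.

(* The trace of [u] on [GD] is the L^2(GD)-limit of the restrictions to [GD] of
   smooth functions on the closed domain converging to [u] in H^1. *)
Definition has_trace Om GD (u : fgrad) (t : Rd -> R) : Prop :=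
  exists w : nat -> Rd -> R,
  [/\ forall m, smooth (w m), H1_cvg Om w u &
      (fun m => \int[surf R n]_(x in GD) (((w m x - t x) ^+ 2)%R)%:E)%E @ \oo
        --> 0%E].

Definition H1_D Om GD : set fgrad :=
  [set u : fgrad | H1 Om u /\ has_trace Om GD u (fun=> 0)].

Definition dirichlet_part Om GD : Prop :=
  GD `<=` boundary Om /\
  measurable (GD : set (caratheodory_type (hausdorff_outer R n n))).

Definition l2 Om (u v : fgrad) : R := integral_on Om (fun x => u.1 x * v.1 x).

Definition bilin Om (alpha : Rd -> 'M[R]_n.+1) (q : Rd -> R) (u v : fgrad) : R :=
  integral_on Om (fun x => dotv (u.2 x *m (alpha x)^T) (v.2 x)) +
  integral_on Om (fun x => q x * u.1 x * v.1 x).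

Definition diffusion_tensor Om (alpha : Rd -> 'M[R]_n.+1) (alpha0 alpha1 : R) :
    Prop :=
  (forall i j, lmeasurable_fun Om (fun x => alpha x i j)) /\
  forall x, Om x -> (alpha x)^T = alpha x /\
  forall xi : 'cV[R]_n.+1,
    alpha0 * enorm xi^T ^+ 2 <= (xi^T *m alpha x *m xi) 0 0
                             <= alpha1 * enorm xi^T ^+ 2.

Definition potential Om q : Prop :=
  lmeasurable_fun Om q /\ exists M, ae_on Om (fun x => 0 <= q x <= M).

End sobolev.

Section eigenvalues.
Context {R : realType} {n : nat}.
Local Notation Rd := 'rV[R]_n.+1.
Local Notation E := (@fgrad R n).
Implicit Types (Om : set Rd) (V : set E) (a : E -> E -> R).

Definition span (m : nat) (b : 'I_m -> E) : set E :=
  [set w | exists c : 'I_m -> R, w = \sum_(i < m) c i *: b i].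

(* [lam k], [phi k] (k >= 0) are the (k+1)-st eigenvalue and eigenfunction.
   The last clause says that the list is complete: every eigenspace is spanned
   by the listed eigenfunctions, so that each eigenvalue occurs in the list as
   often as its multiplicity. *)
Definition eigen_system Om V a (lam : nat -> R) (phi : nat -> E) : Prop :=
  [/\ 0 <= lam 0%N /\ (forall i j, (i <= j)%N -> lam i <= lam j),
      forall k, V (phi k),
      forall i j, l2 Om (phi i) (phi j) = (i == j)%:R,
      forall k v, V v -> a (phi k) v = lam k * l2 Om (phi k) v &
      forall mu u, V u -> (forall v, V v -> a u v = mu * l2 Om u v) ->
        exists (m : nat) (c : 'I_m -> R),
          (forall i : 'I_m, lam i != mu -> c i = 0) /\
          ae_on Om (fun x => u.1 x = (\sum_(i < m) c i *: phi i).1 x)].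

(* W_{k+1} in the one-based numbering. *)
Definition W (phi : nat -> E) (k : nat) : set E :=
  span (fun i : 'I_k.+1 => phi i).

(* Linear independence is in L^2, that is, modulo equality a.e. *)
Definition is_basis Om (N : nat) (psi : 'I_N -> E) (Vh : set E) : Prop :=
  Vh = span psi /\
  forall c : 'I_N -> R,
    ae_on Om (fun x => (\sum_(i < N) c i *: psi i).1 x = 0) ->
    forall i, c i = 0.

Definition has_dim Om (Vh : set E) (N : nat) : Prop :=
  exists psi : 'I_N -> E, is_basis Om psi Vh.

(* [lamh] lists in nondecreasing order the roots, with multiplicity, of the
   characteristic polynomial of the operator [Lh] of [Vh]. *)
Definition operator_eigenvalues Om (Vh : set E) (Lh : E -> E) (N : nat)
    (lamh : 'I_N -> R) : Prop :=
  (forall i j : 'I_N, (i <= j)%N -> lamh i <= lamh j) /\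
  exists (psi : 'I_N -> E) (A : 'M[R]_N),
    [/\ is_basis Om psi Vh,
        forall j, Lh (psi j) = \sum_(i < N) A i j *: psi i &
        char_poly A = \prod_(i < N) ('X - (lamh i)%:P)].

Definition discrete_operator Om a (Vh : set E) (Lh : E -> E) : Prop :=
  forall u, Vh u -> Vh (Lh u) /\ forall v, Vh v -> l2 Om (Lh u) v = a u v.

Definition L2_projection Om V (Vh : set E) (Qh : E -> E) : Prop :=
  forall v, V v -> Vh (Qh v) /\ forall w, Vh w -> l2 Om (Qh v) w = l2 Om v w.

End eigenvalues.

Section triangulations.
Context {R : realType} {n : nat}.
Local Notation Rd := 'rV[R]_n.+1.
Local Notation vertices := ('I_n.+2 -> Rd).

Definition face (p : vertices) (F : {set 'I_n.+2}) : set Rd :=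
  [set x | exists t : 'I_n.+2 -> R,
     [/\ forall i, 0 <= t i, forall i, i \notin F -> t i = 0,
         \sum_i t i = 1 & x = \sum_i t i *: p i]].

Definition simplex (p : vertices) : set Rd := face p [set: 'I_n.+2]%SET.

Definition nondegenerate (p : vertices) : Prop :=
  row_free (\matrix_(i < n.+1) (p (lift ord0 i) - p ord0)).

(* Any two simplices intersect in the common face spanned by their common
   vertices, which is empty if there are none. *)
Definition triangulation (Om : set Rd) (M : nat) (Th : 'I_M -> vertices) :
    Prop :=
  [/\ forall s, nondegenerate (Th s),
      closure Om = \bigcup_s simplex (Th s) &
      forall s t, simplex (Th s) `&` simplex (Th t) =
        face (Th s) [set i | [exists j, Th s i == Th t j]]%SET].

Definition mesh_size (M : nat) (Th : 'I_M -> vertices) : R :=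
  \big[Num.max/0]_(s < M) diam (simplex (Th s)).

Definition polynomial_fun (p : nat) (f : Rd -> R) : Prop :=
  exists c : {ffun 'I_n.+1 -> 'I_p.+1} -> R,
  forall x, f x = \sum_(m : {ffun 'I_n.+1 -> 'I_p.+1} |
                        (\sum_(i < n.+1) m i <= p)%N)
                    c m * \prod_(i < n.+1) x 0 i ^+ m i.

Definition fe_space (V : set (@fgrad R n)) (M : nat) (Th : 'I_M -> vertices)
    (p : nat) (Vh : set (@fgrad R n)) : Prop :=
  Vh `<=` V /\
  forall u, Vh u -> forall s, exists2 f, polynomial_fun p f &
    ae_on (simplex (Th s)) (fun x => u.1 x = f x).

End triangulations.

(* Main.v *)
Require Import Defs.
From HB Require Import structures.
From mathcomp Require Import ring lra measurable_realfun.

(**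
Min-max gives both inequalities once the Rayleigh quotient on
[V] orthogonally to the first [k] eigenfunctions is bounded below by [lam k].
No compact embedding is needed for this bound: the hypothesis
[||v - Qh v||^2 <= c2 h^2 |v|_a^2] says that [V] is finite-dimensional up to
vectors with [|v|_a^2 >= ||v||^2 / (c2 h^2)], and [lam k < 1 / (2 c2 h^2)]. A
minimizing sequence therefore has an energy-Cauchy subsequence; as [V] is
complete for the H1 norm, a Rayleigh quotient smaller than [lam k] would be
attained by an eigenfunction missing from the list.

For the upper bound, pick a unit vector [w] in [W_k] whose projection is
orthogonal to the first discrete eigenfunctions and put
[t = ||w - Qh w||^2 < 1 / 2]. Then
[sqrt (lamh k) <= |Qh w|_a / sqrt (1 - t) <= (1 + t) |Qh w|_a], and
[t |Qh w|_a <= c1 / 2 |w - Qh w|_a] because [t <= c2 h^2 |w - Qh w|_a^2] and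
because [I - Qh] has the same energy norm as [Qh].
*)

Local Open Scope classical_set_scope.
Local Open Scope ring_scope.

Set Implicit Arguments.
Unset Strict Implicit.

(** * Semi-inner products and compactness *)

(** The list [lam], [phi] is known to exhaust each eigenspace but is not given as a basis of [V], so
    the lower Rayleigh bound cannot be read off an eigenfunction expansion. The analysis lies in the
    completeness of [V]: Riesz-Fischer gives limits in L2, and under Dirichlet conditions the
    vanishing trace must survive limits, which requires continuous functions to be measurable for
    the Lebesgue and the Hausdorff outer measure alike. The number 1/2 in the bound on [lam k] acts
    twice. It keeps t in a range where 1 <= (1 + t)^2 (1 - t), and it turns K c1 lam_k into c1 / 2,
    where K = c2 h^2 and K c1 lam_k bounds K |Qh w|_a |w - Qh w|_a. For the latter both energy norms
    must be at most sqrt (c1 lam_k); hence Kato's equality of the norms of a projection and its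
    complement. Indices start at 0: [lam k] and [lamh k] are eigenvalues number k + 1, and k
    orthogonality conditions are imposed on spans of dimension k + 1. *)

Lemma nonneg_quadratic_discr {R : realFieldType} (A B C : R) :
  0 <= C -> (forall s, 0 <= A + 2 * s * B + s ^+ 2 * C) -> B ^+ 2 <= A * C.
Proof.
move=> C0 H; have [C_eq0|Cn0] := eqVneq C 0.
  rewrite C_eq0 mulr0 real_leNgt ?num_real//; apply/negP => B2.
  have Bn0 : B != 0 by apply: contraTneq B2 => ->; rewrite expr0n ltxx.
  (* With C = 0 the expression is affine in s, and this s makes it -1. *)
  have := H (- (A + 1) / (2 * B)); rewrite C_eq0 mulr0 addr0.
  have -> : A + 2 * (- (A + 1) / (2 * B)) * B = - 1 by field.
  by rewrite ler0N1.
have C_gt0 : 0 < C by rewrite lt_neqAle eq_sym Cn0.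
have := H (- B / C).
have -> : A + 2 * (- B / C) * B + (- B / C) ^+ 2 * C = (A * C - B ^+ 2) / C.
  by field.
by rewrite pmulr_lge0 ?invr_gt0// subr_ge0.
Qed.

Lemma cvg0_sqr_le {R : realType} (x y : nat -> R) (C : R) :
  (forall m, x m ^+ 2 <= y m * C) -> y @ \oo --> 0 -> x @ \oo --> 0.
Proof.
move=> xy y0; apply/cvgrPdist_le => /= e e0.
have C0 : 0 < `|C| + 1 by rewrite ltr_wpDl.
have d0 : 0 < e ^+ 2 / (`|C| + 1) by rewrite divr_gt0 ?exprn_gt0.
move/cvgrPdist_le : y0 => /(_ _ d0) [m0 _ hm]; exists m0 => //= m mm0.
have := hm m mm0; rewrite /= !sub0r !normrN => h1.
rewrite -(@ler_pXn2r _ 2) ?nnegrE ?normr_ge0 ?(ltW e0)//.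
rewrite real_normK ?num_real//; apply: (le_trans (xy m)).
move: h1; rewrite ler_pdivlMr// => h1; apply: le_trans h1.
apply: le_trans (ler_norm _) _; rewrite normrM ler_wpM2l//.
by rewrite lerDl.
Qed.

Section semi_inner_product.
Context {R : realType} {E : lmodType R}.
Implicit Types (b : E -> E -> R) (u v w : E).

(** Definiteness is left out: vectors will be genuine functions, so the L2 form vanishes on
    functions that are zero a.e., and the energy can vanish on constants. *)
Record semi_inner b : Prop := SemiInner {
  semi_innerP : forall c u v w, b (c *: u + v) w = c * b u w + b v w;
  semi_innerC : forall u v, b u v = b v u;
  semi_inner_ge0 : forall u, 0 <= b u u }.

Context (b : E -> E -> R) (hb : semi_inner b).

Lemma siDl u v w : b (u + v) w = b u w + b v w.
Proof. by rewrite -[u]scale1r (semi_innerP hb) mul1r scale1r. Qed.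

Lemma si0l w : b 0 w = 0.
Proof. by apply: (addrI (b 0 w)); rewrite -siDl !addr0. Qed.

Lemma siZl c u w : b (c *: u) w = c * b u w.
Proof. by rewrite -[c *: u]addr0 (semi_innerP hb) si0l addr0. Qed.

Lemma siDr u v w : b w (u + v) = b w u + b w v.
Proof. by rewrite (semi_innerC hb) siDl !(semi_innerC hb _ w). Qed.

Lemma siZr c u w : b w (c *: u) = c * b w u.
Proof. by rewrite (semi_innerC hb) siZl (semi_innerC hb). Qed.

Lemma si0r w : b w 0 = 0.
Proof. by rewrite (semi_innerC hb) si0l. Qed.

Lemma siNl u w : b (- u) w = - b u w.
Proof. by rewrite -scaleN1r siZl mulN1r. Qed.

Lemma siNr u w : b w (- u) = - b w u.
Proof. by rewrite (semi_innerC hb) siNl (semi_innerC hb). Qed.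

Definition siE := (siDl, siDr, siNl, siNr, siZl, siZr, si0l, si0r).

Lemma si_suml I (r : seq I) (F : I -> E) w :
  b (\sum_(i <- r) F i) w = \sum_(i <- r) b (F i) w.
Proof.
by elim: r => [|i r IH]; rewrite ?big_nil ?big_cons ?si0l // siDl IH.
Qed.

Lemma si_sumr I (r : seq I) (F : I -> E) w :
  b w (\sum_(i <- r) F i) = \sum_(i <- r) b w (F i).
Proof.
by rewrite (semi_innerC hb) si_suml; under eq_bigr do rewrite (semi_innerC hb).
Qed.

Lemma si_sqrD u v : b (u + v) (u + v) = b u u + 2 * b u v + b v v.
Proof. by rewrite !siE (semi_innerC hb v u); ring. Qed.

Lemma si_CauchySchwarz u v : b u v ^+ 2 <= b u u * b v v.
Proof.
apply: nonneg_quadratic_discr; first exact: semi_inner_ge0 hb v.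
move=> s; have := semi_inner_ge0 hb (u + s *: v).
by rewrite si_sqrD !siE; congr (_ <= _); ring.
Qed.

Lemma si_triangle u v :
  Num.sqrt (b (u + v) (u + v)) <= Num.sqrt (b u u) + Num.sqrt (b v v).
Proof.
rewrite -(@ler_pXn2r _ 2) ?nnegrE ?addr_ge0 ?sqrtr_ge0//.
rewrite sqrrD !sqr_sqrtr ?(semi_inner_ge0 hb)// si_sqrD lerD2r lerD2l.
rewrite -[(_ * _) *+ 2]mulr_natl ler_pM2l// -sqrtrM ?(semi_inner_ge0 hb)//.
apply: (le_trans (ler_norm _)); rewrite -sqrtr_sqr ler_sqrt ?si_CauchySchwarz//.
by rewrite mulr_ge0 ?(semi_inner_ge0 hb).
Qed.

Lemma si_cvgr (v : nat -> E) u w :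
  (fun m => b (v m - u) (v m - u)) @ \oo --> 0 ->
  (fun m => b (v m) w) @ \oo --> b u w.
Proof.
move=> h; have h0 : (fun m => b (v m - u) w) @ \oo --> 0.
  exact: (cvg0_sqr_le (fun m => si_CauchySchwarz (v m - u) w) h).
have -> : (fun m => b (v m) w) = (fun m => b (v m - u) w) \+ (fun=> b u w).
  by apply/funext => m /=; rewrite !siE subrK.
by rewrite -[X in _ --> X]add0r; apply: cvgD h0 _; exact: cvg_cst.
Qed.

Lemma si_cvg_sqr (v : nat -> E) u :
  (fun m => b (v m - u) (v m - u)) @ \oo --> 0 ->
  (fun m => b (v m) (v m)) @ \oo --> b u u.
Proof.
move=> h.
have -> : (fun m => b (v m) (v m)) =
    (fun m => b (v m - u) (v m - u) + (2 * b (v m) u - b u u)).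
  by apply/funext => m; rewrite !siE (semi_innerC hb u); ring.
rewrite -[X in _ --> X]add0r; apply: cvgD => //.
have {2}-> : b u u = 2 * b u u - b u u by ring.
by apply: cvgB; [apply: cvgM; [exact: cvg_cst|exact: si_cvgr]|exact: cvg_cst].
Qed.

End semi_inner_product.

Section orthonormal.
Context {R : realType} {E : lmodType R} (b : E -> E -> R) (hb : semi_inner b).
Context (I : finType) (e : I -> E) (he : forall i j, b (e i) (e j) = (i == j)%:R).

Lemma orthonormal_coord (x : I -> R) i : b (\sum_j x j *: e j) (e i) = x i.
Proof.
rewrite (si_suml hb) (bigD1 i)//= big1 ?addr0 => [|j ji].
  by rewrite (siZl hb) he eqxx mulr1.
by rewrite (siZl hb) he (negbTE ji) mulr0.
Qed.

Lemma orthonormal_norm (x : I -> R) :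
  b (\sum_j x j *: e j) (\sum_j x j *: e j) = \sum_j x j ^+ 2.
Proof.
rewrite (si_sumr hb); apply: eq_bigr => i _.
by rewrite (siZr hb) orthonormal_coord expr2.
Qed.

End orthonormal.

(** The first-order condition at a minimizer, with B the first variation. Testing at t = - B / (C +
    1) instead of - B / C covers C = 0 as well; C >= 0 comes from t = 1 and t = -1. *)
Lemma quadratic_nonneg_linear0 {R : realFieldType} (B C : R) :
  (forall t, 0 <= 2 * t * B + t ^+ 2 * C) -> B = 0.
Proof.
move=> h; have C0 : 0 <= C by have := h 1; have := h (-1); lra.
have C1 : C + 1 != 0 by rewrite gt_eqF// ltr_wpDl.
have := h (- B / (C + 1)).
have -> : 2 * (- B / (C + 1)) * B + (- B / (C + 1)) ^+ 2 * C =
  - ((B / (C + 1)) ^+ 2 * (C + 2)) by field.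
rewrite oppr_ge0 pmulr_lle0 ?ltr_wpDl// => h2.
have /eqP : (B / (C + 1)) ^+ 2 = 0 by apply/eqP; rewrite eq_le h2 sqr_ge0.
by rewrite sqrf_eq0 mulf_eq0 invr_eq0 (negbTE C1) orbF => /eqP.
Qed.

(* Bolzano-Weierstrass, in the form [s j >= j] rather than [s] increasing. *)
Lemma bounded_family_subseq {R : realType} (N : nat) (x : nat -> 'I_N -> R) :
  (forall m i, `|x m i| <= 1) ->
  exists (s : nat -> nat) (y : 'I_N -> R),
    forall j, (j <= s j)%N /\ forall i, `|x (s j) i - y i| <= j.+1%:R^-1.
Proof.
move=> hx; pose A := [set v : 'rV[R]_N | forall i, `[(-1), 1]%classic (v ord0 i)].
have Ac : compact A by by apply: (@rV_compact R N (fun=> `[(-1), 1]%classic)) => i; exact: segment_compact.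
pose X m : 'rV[R]_N := \row_i x m i.
have XA : \forall m \near \oo, A (X m).
  by near=> m => i; rewrite /= in_itv /= mxE -ler_norml.
have [c [_ cc]] := Ac (X @ \oo) (fmap_proper_filter _ _) XA.
pose P j m := (j <= m)%N /\ forall i, `|x m i - c ord0 i| <= j.+1%:R^-1.
have Pex j : exists m, P j m.
  have F1 : (X @ \oo) (X @` [set m | (j <= m)%N]).
    by exists j => //= m jm; exists m.
  have F2 : nbhs c [set v : 'rV[R]_N | forall i, `|v ord0 i - c ord0 i| < j.+1%:R^-1].
    apply/nbhs_ballP; exists (j.+1%:R^-1) => /=; first by rewrite invr_gt0.
    by move=> v [_ cv] i; have := cv ord0 i; rewrite /ball /= distrC.
  have [v [[m jm <-] h]] := cc _ _ F1 F2.
  by exists m; split => // i; have /ltW := h i; rewrite mxE.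
by have [s hs] := choice Pex; exists s, (fun i => c ord0 i) => j; exact: hs.
Unshelve. all: by end_near. Qed.

(** * Lower bound by minimization *)

Section spectral_lower_bound.
Context {R : realType} {E : lmodType R} (a b : E -> E -> R).
Context (ha : semi_inner a) (hb : semi_inner b).
Context (complete_ab : forall v : nat -> E,
  (forall eps, 0 < eps -> exists m0, forall m l, (m0 <= m)%N -> (m0 <= l)%N ->
     a (v m - v l) (v m - v l) + b (v m - v l) (v m - v l) <= eps) ->
  exists u, (fun m => a (v m - u) (v m - u)) @ \oo --> 0 /\
            (fun m => b (v m - u) (v m - u)) @ \oo --> 0).
Context (lam : nat -> R) (phi : nat -> E).
Context (lam_mono : forall i j, (i <= j)%N -> lam i <= lam j).
Context (phi_orth : forall i j, b (phi i) (phi j) = (i == j)%:R).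
Context (phi_eigen : forall i v, a (phi i) v = lam i * b (phi i) v).
(** Completeness of the list in the form used below: the a.e. expansion of an eigenvector u is
    paired with u itself, which keeps a.e. equality out of the abstract setting. *)
Context (phi_complete : forall mu u, (forall v, a u v = mu * b u v) ->
  exists (m : nat) (c : 'I_m -> R),
    (forall i : 'I_m, lam i != mu -> c i = 0) /\
    b u u = \sum_(i < m) c i * b (phi i) u).
Context (N : nat) (e : 'I_N -> E) (e_norm : forall i, b (e i) (e i) <= 1).
Context (K : R) (K_gt0 : 0 < K).
Context (finite_rank :
  forall v, b v v <= \sum_(i < N) b v (e i) ^+ 2 + K * a v v).
Context (k : nat) (lamK : lam k * K < 1).

Local Notation X := [set v | forall i, (i < k)%N -> b v (phi i) = 0].

Lemma orthogonal_part w :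
  exists2 w', X w' & w = w' + \sum_(i < k) b w (phi i) *: phi i.
Proof.
exists (w - \sum_(i < k) b w (phi i) *: phi i); last by rewrite subrK.
move=> i ik; rewrite /= (siDl hb) (siNl hb).
have -> := orthonormal_coord hb (e := fun i : 'I_k => phi i) _
  (fun i => b w (phi i)) (Ordinal ik); last by move=> *; exact: phi_orth.
by rewrite subrr.
Qed.

(* On a minimizing sequence the parallelogram law bounds [a d] by [mu * b d] up
   to a small error; once the finitely many coordinates [b d (e i)] are small
   this contradicts [b d <= o(1) + K * a d] with [K * mu < 1], unless [b d] is
   small. *)
Lemma minimizer_exists v0 : X v0 -> a v0 v0 < lam k * b v0 v0 ->
  exists mu u, [/\ mu < lam k, X u, b u u = 1, a u u = mu &
    forall v, X v -> mu * b v v <= a v v].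
Proof.
move=> Xv0 av0.
have bpos w : a w w < lam k * b w w -> 0 < b w w.
  have := semi_inner_ge0 ha w; have := semi_inner_ge0 hb w.
  by rewrite le_eqVlt => /orP[/eqP <-|//]; rewrite mulr0 leNgt => /negbTE ->.
have normalize w : X w -> 0 < b w w ->
    X ((Num.sqrt (b w w))^-1 *: w) /\
    (forall f, semi_inner f ->
     f ((Num.sqrt (b w w))^-1 *: w) ((Num.sqrt (b w w))^-1 *: w) = f w w / b w w).
  move=> Xw bw; split=> [i ik /=|f hf]; first by rewrite (siZl hb) Xw ?mulr0.
  rewrite !(siE hf) mulrA -expr2 exprVn sqr_sqrtr ?(ltW bw)//.
  by rewrite mulrC.
pose S := [set a v v | v in [set v | X v /\ b v v = 1]].
have S_inf : has_inf S.
  split; last by exists 0 => _ [v _ <-]; exact: semi_inner_ge0 ha v.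
  have [h1 h2] := normalize _ Xv0 (bpos _ av0).
  eexists; eexists; last reflexivity; split; first exact: h1.
  by rewrite h2// divff// gt_eqF ?bpos.
pose mu := inf S.
have mu_ge0 : 0 <= mu.
  by apply: lb_le_inf S_inf.1 _ => _ [v _ <-]; exact: semi_inner_ge0 ha v.
have mu_le v : X v -> mu * b v v <= a v v.
  move=> Xv; have := semi_inner_ge0 hb v; rewrite le_eqVlt => /orP[/eqP <-|bv].
    by rewrite mulr0; exact: semi_inner_ge0 ha v.
  rewrite -ler_pdivlMr//; have [h1 h2] := normalize _ Xv bv.
  rewrite -(h2 _ ha); apply: (ge_inf S_inf.2); eexists; last reflexivity.
  by split=> //; rewrite h2// divff// gt_eqF.
have mu_lt : mu < lam k.
  have b0 := bpos _ av0; rewrite -(ltr_pM2r b0).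
  exact: le_lt_trans (mu_le _ Xv0) av0.
(* This gap allows [K * mu * b d d] to be absorbed into [b d d] for differences d of the minimizing
   sequence. *)
have Kmu : 0 < 1 - K * mu.
  by rewrite subr_gt0 mulrC; apply: le_lt_trans lamK; rewrite ler_pM2r// ltW.
have /choice[v hv] : forall m : nat, exists v,
    [/\ X v, b v v = 1 & a v v <= mu + m.+1%:R^-1].
  move=> m; have m0 : 0 < m.+1%:R^-1 :> R by rewrite invr_gt0.
  have [_ [v [Xv bv] <-] /ltW h] := inf_adherent m0 S_inf.
  by exists v.
have coord_le m i : `|b (v m) (e i)| <= 1.
  have [_ bv _] := hv m; rewrite -(@ler_pXn2r _ 2) ?nnegrE// real_normK ?num_real//.
  by rewrite expr1n (le_trans (si_CauchySchwarz hb _ _))// bv mul1r.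
have [s [y hs]] := bounded_family_subseq coord_le.
(* Obtained by solving b d d <= 2 N tau + K (mu b d d + 2 tau) for b d d: the first term bounds the
   coordinates of d, the second its energy. *)
pose C := (2 * N%:R + 2 * K) / (1 - K * mu).
have C_ge0 : 0 <= C by rewrite divr_ge0 ?ltW// ltr_wpDl ?mulr_ge0 ?mulr_gt0.
have hvs j : a (v (s j)) (v (s j)) <= mu + j.+1%:R^-1.
  have [_ _ h] := hv (s j); apply: (le_trans h); rewrite lerD2l lef_pV2 ?posrE//.
  by rewrite ler_nat ltnS (hs j).1.
pose r (m : nat) : R := m.+1%:R^-1.
have r_ge0 m : 0 <= r m by rewrite /r invr_ge0.
have {}hvs j : a (v (s j)) (v (s j)) <= mu + r j by exact: hvs.
have close j l (tau := r j + r l) (d := v (s j) - v (s l)) :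
    a d d + b d d <= (C + mu * C + 2) * tau.
  have [Xj bj _] := hv (s j); have [Xl bl _] := hv (s l).
  have tau_ge0 : 0 <= tau by rewrite addr_ge0 ?r_ge0.
  have inv_le1 m : r m <= 1 by rewrite /r invf_le1// ler1n.
  have tau_le2 : tau <= 2 by have := inv_le1 j; have := inv_le1 l; rewrite /tau; lra.
  (* Parallelogram law for two unit vectors x and y of the sequence: a d d = 2 a x x + 2 a y y - a
     (x + y) (x + y), where the subtracted term is at least mu (4 - b d d) because x + y lies in
     [X]. *)
  have A1 : a d d <= mu * b d d + 2 * tau.
    have Xs : X (v (s j) + v (s l)).
      by move=> i ik; rewrite /= (siDl hb) Xj ?Xl ?addr0.
    have := mu_le _ Xs; have := hvs j; have := hvs l.
    rewrite /d /tau !(siE ha) !(siE hb) bj bl (semi_innerC ha (v (s l))).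
    by rewrite (semi_innerC hb (v (s l))); lra.
  (* Each coordinate of d is at most tau in absolute value, and tau <= 2 makes the bound on its
     square linear in tau. *)
  have A2 : \sum_(i < N) b d (e i) ^+ 2 <= 2 * N%:R * tau.
    apply: (@le_trans _ _ (\sum_(i < N) 2 * tau)); last first.
      by rewrite sumr_const card_ord -[_ *+ N]mulr_natl mulrA (mulrC N%:R).
    apply: ler_sum => i _.
    have bt : `|b d (e i)| <= tau.
      have -> : b d (e i) = b (v (s j)) (e i) - y i - (b (v (s l)) (e i) - y i).
        by rewrite /d !(siE hb); ring.
      by apply: (le_trans (ler_normB _ _)); rewrite lerD ?(hs _).2.
    rewrite -[X in X <= _]real_normK ?num_real//.
    apply: (@le_trans _ _ (tau ^+ 2)); first by rewrite lerXn2r ?nnegrE.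
    by rewrite expr2 ler_wpM2r.
  have bd : b d d <= C * tau.
    rewrite /C mulrAC ler_pdivlMr//.
    have := finite_rank d; have := ler_wpM2l (ltW K_gt0) A1; move: A2; clear; clearbody d tau => *; nra.
  have mubd := ler_wpM2l mu_ge0 bd; move: A1 bd mubd; clear; clearbody d tau => *; nra.
have [u [au bu]] : exists u,
    (fun j => a (v (s j) - u) (v (s j) - u)) @ \oo --> 0 /\
    (fun j => b (v (s j) - u) (v (s j) - u)) @ \oo --> 0.
  apply: complete_ab => eps eps0.
  pose D := C + mu * C + 2.
  have D_gt0 : 0 < D by rewrite ltr_wpDl// addr_ge0// mulr_ge0.
  have [m0 hm0] : exists m0 : nat, D * 2 / eps <= m0.+1%:R.
    exists (Num.bound (D * 2 / eps)); rewrite ltW//.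
    apply: lt_trans (archi_boundP _) _; last by rewrite ltr_nat.
    by rewrite divr_ge0 ?mulr_ge0 ?ltW.
  exists m0 => m l m0m m0l; apply: (le_trans (close m l)).
  have inv_le i : (m0 <= i)%N -> i.+1%:R^-1 <= m0.+1%:R^-1 :> R.
    by move=> h; rewrite lef_pV2 ?posrE// ler_nat ltnS.
  apply: (@le_trans _ _ (D * (2 * m0.+1%:R^-1))).
    by rewrite ler_pM2l// mulr_natl mulr2n lerD ?inv_le.
  by move: hm0; rewrite ler_pdivrMr// mulrA ler_pdivrMr// [eps * _]mulrC.
have Xu : X u.
  move=> i ik; apply: (cvg_unique _ (si_cvgr hb (w := phi i) bu)) => //.
  rewrite (_ : (fun _ => _) = cst 0); first exact: cvg_cst.
  by apply/funext => j; have [Xj _ _] := hv (s j); rewrite Xj.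
have bu1 : b u u = 1.
  apply: (cvg_unique _ (si_cvg_sqr hb bu)) => //.
  rewrite (_ : (fun _ => _) = cst 1); first exact: cvg_cst.
  by apply/funext => j; have [_ -> _] := hv (s j).
exists mu, u; split => //; apply/eqP; rewrite eq_le; apply/andP; split; last first.
  by have := mu_le _ Xu; rewrite bu1 mulr1.
apply/ler_addgt0Pr => eps eps0.
have := si_cvg_sqr ha au => /cvgrPdist_le /(_ (eps / 2)).
case; first by rewrite divr_gt0.
move=> m0 _ hm0.
have [m1 hm1] : exists m1 : nat, 2 / eps <= m1.+1%:R.
  exists (Num.bound (2 / eps)); rewrite ltW//.
  by apply: lt_trans (archi_boundP _) _; rewrite ?ltr_nat// divr_ge0 ?ltW.
have /= := hm0 (maxn m0 m1) (leq_maxl _ _); have := hvs (maxn m0 m1).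
have : r (maxn m0 m1) <= eps / 2.
  rewrite /r.
  rewrite -[eps / 2]invrK lef_pV2 ?posrE ?invr_gt0 ?divr_gt0// invfM invrK mulrC.
  by apply: (le_trans hm1); rewrite ler_nat ltnS leq_maxr.
by rewrite ler_norml; lra.
Qed.

(** A minimizer u with value mu < lam k satisfies the eigenvalue equation against [X] by the first
    variation, and against each [phi i] with i < k because both sides vanish. Being an eigenvector,
    u expands in those [phi i] with lam i = mu; monotonicity forces i < k, so all of them are
    orthogonal to u, contradicting b u u = 1. *)
Lemma spectral_lower_bound v : X v -> lam k * b v v <= a v v.
Proof.
move=> Xv; rewrite leNgt; apply/negP => /(minimizer_exists Xv).
move=> [mu [u [mu_lt Xu bu au mu_le]]].
have u_eigen_X w : X w -> a u w = mu * b u w.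
  move=> Xw; apply/eqP; rewrite -subr_eq0; apply/eqP.
  apply: (@quadratic_nonneg_linear0 _ _ (a w w - mu * b w w)) => t.
  have Xt : X (u + t *: w).
    by move=> i ik; rewrite /= (siDl hb) (siZl hb) Xu ?Xw ?mulr0 ?addr0.
  have := mu_le _ Xt; rewrite !(siE ha) !(siE hb) bu au.
  by rewrite (semi_innerC ha w) (semi_innerC hb w); lra.
have u_eigen w : a u w = mu * b u w.
  have [w' Xw' ->] := orthogonal_part w.
  rewrite (siDr ha) (siDr hb) u_eigen_X// (si_sumr ha) (si_sumr hb).
  rewrite !big1 ?addr0// => i _; first by rewrite (siZr hb) Xu ?mulr0.
  by rewrite (siZr ha) (semi_innerC ha) phi_eigen (semi_innerC hb (phi i)) Xu ?mulr0.
have [m [c [hc]]] := phi_complete u_eigen.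
rewrite bu big1 => [/eqP|i _]; first by rewrite oner_eq0.
have [lami|] := eqVneq (lam i) mu; last by move=> /hc ->; rewrite mul0r.
rewrite (semi_innerC hb) Xu ?mulr0// ltnNge; apply/negP => /lam_mono.
by rewrite lami leNgt mu_lt.
Qed.

End spectral_lower_bound.

(** * Simultaneous diagonalization *)

Lemma char_poly_trmx {R : comNzRingType} n (A : 'M[R]_n) :
  char_poly A^T = char_poly A.
Proof.
rewrite /char_poly -[RHS]det_tr; congr (\det _).
by apply/matrixP => i j; rewrite !mxE eq_sym.
Qed.

Lemma char_poly_conj {R : idomainType} n (P A B : 'M[R]_n) :
  P \in unitmx -> P *m A = B *m P -> char_poly A = char_poly B.
Proof.
move=> Pu PA; have Qu : map_mx polyC P \in unitmx.
  by rewrite unitmxE det_map_mx rmorph_unit// -unitmxE.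
have : map_mx polyC P *m char_poly_mx A = char_poly_mx B *m map_mx polyC P.
  by rewrite /char_poly_mx mulmxBr mulmxBl -!map_mxM PA scalar_mxC.
move=> /(congr1 determinant); rewrite !det_mulmx mulrC => /mulIr; apply.
by rewrite -unitmxE.
Qed.

Lemma complement_rows {F : fieldType} n (u : 'cV[F]_n.+1) : u != 0 ->
  exists2 D : 'M[F]_(n, n.+1), row_free D & D *m u = 0.
Proof.
move=> u0; have rk : \rank (kermx u) = n.
  by rewrite mxrank_ker -mxrank_tr rank_rV trmx_eq0 u0 subn1.
have : row_base (kermx u) *m u = 0.
  by apply/sub_kermxP; rewrite eq_row_base.
have := row_base_free (kermx u).
move: (row_base (kermx u)); rewrite rk => D ? ?; by exists D.
Qed.

(** [B] acts on row vectors and is self-adjoint for the inner product [G]. As its characteristic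
    polynomial splits, an eigenvector for the first root can be scaled to [G]-norm 1 and completed
    by a basis [D] of its [G]-orthogonal complement, where induction applies. The diagonal keeps the
    given order of the roots. *)
Lemma symmetric_pencil_diag {R : rcfType} n (G B : 'M[R]_n) (l : 'I_n -> R) :
  G^T = G -> (forall x : 'rV[R]_n, x != 0 -> 0 < (x *m G *m x^T) 0 0) ->
  (B *m G)^T = B *m G -> char_poly B = \prod_i ('X - (l i)%:P) ->
  exists P : 'M[R]_n, P *m G *m P^T = 1%:M /\ P *m B = diag_mx (\row_i l i) *m P.
Proof.
elim: n G B l => [|n IH] G B l symG posG symBG charB.
  by exists 1%:M; rewrite ![_ *m _]flatmx0 ?[1%:M]flatmx0.
have [v0 v0B v0n0] : exists2 v : 'rV_n.+1, v *m B = l ord0 *: v & v != 0.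
  apply/eigenvalueP; rewrite eigenvalue_root_char charB big_ord_recl rootM.
  by rewrite root_XsubC eqxx.
have c_gt0 := posG _ v0n0; set c := (_ *m _) 0 0 in c_gt0.
pose v : 'rV[R]_n.+1 := (Num.sqrt c)^-1 *: v0.
have vB : v *m B = l ord0 *: v by rewrite -scalemxAl v0B scalerA mulrC -scalerA.
have vGv : v *m G *m v^T = 1%:M.
  apply/rowP => i; rewrite !ord1 linearZ /= -!scalemxAl -scalemxAr scalerA.
  rewrite mxE -/c !mxE eqxx -expr2 exprVn sqr_sqrtr ?(ltW c_gt0)//.
  by rewrite mulVf// gt_eqF.
have [D freeD DGv] : exists2 D : 'M[R]_(n, n.+1), row_free D & D *m (G *m v^T) = 0.
  apply: complement_rows; apply: contra_eq_neq vGv; rewrite -mulmxA => ->.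
  by rewrite mulmx0 eq_sym; apply/eqP => /rowP /(_ 0) /eqP; rewrite !mxE oner_eq0.
have vGD : v *m G *m D^T = 0.
  by apply: trmx_inj; rewrite !trmx_mul trmxK symG DGv trmx0.
pose P0 : 'M[R]_(1 + n, n.+1) := @col_mx R 1 n n.+1 v D.
pose G2 := D *m G *m D^T.
have P0G : P0 *m G *m P0^T = block_mx 1%:M 0 0 G2.
  by rewrite /P0 mul_col_mx tr_col_mx mul_col_row vGv vGD -mulmxA DGv.
have P0u : (P0 : 'M[R]_n.+1) \in unitmx.
  rewrite -row_free_unit; apply/inj_row_free => x xP0.
  move: xP0; rewrite -[x](@hsubmxK _ 1 1 n) /P0 (@mul_row_col _ 1 1 n).
  set s := lsubmx _; set y := rsubmx _ => e.
  have s0 : s = 0.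
    have := congr1 (mulmx^~ (G *m v^T)) e.
    by rewrite /= mulmxDl -[y *m D *m _]mulmxA DGv mulmx0 addr0 -mulmxA [v *m _]mulmxA vGv mulmx1 mul0mx.
  move: e; rewrite s0 mul0mx add0r => /eqP; rewrite (mulmx_free_eq0 _ freeD).
  by move=> /eqP ->; rewrite row_mx0.
(* The matrix of [B] in the basis of the rows of [P0], whose Gram matrix has diagonal blocks 1 and
   [G2]. *)
pose B' : 'M[R]_(1 + n) := P0 *m B *m invmx P0.
have P0B : P0 *m B = B' *m P0 by rewrite /B' mulmxKV.
have B'G : B' *m block_mx 1%:M 0 0 G2 = P0 *m (B *m G) *m P0^T.
  by rewrite -P0G !mulmxA -P0B.
have symB' : (B' *m block_mx 1%:M 0 0 G2)^T = B' *m block_mx 1%:M 0 0 G2.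
  by rewrite B'G trmx_mul trmxK [(P0 *m _)^T]trmx_mul symBG mulmxA.
have usubB' : usubmx B' = row_mx (l ord0)%:M 0.
  apply: (can_inj (mulmxK P0u)); rewrite mul_usub_mx -P0B.
  rewrite -mul_usub_mx /P0 col_mxKu vB.
  apply: etrans (esym (mul_row_col _ _ v D)).
  by rewrite mul_scalar_mx mul0mx addr0.
pose B1 : 'M[R]_(n, 1) := lsubmx (dsubmx B'); pose B2 : 'M[R]_n := rsubmx (dsubmx B').
have B'E : B' = block_mx (l ord0)%:M 0 B1 B2.
  by rewrite block_mxEv -usubB' hsubmxK vsubmxK.
(* The first row of [B'] is zero off the diagonal since [v] is an eigenvector; symmetry of [B']
   times the Gram matrix carries this over to the first column, so [B1] vanishes. *)
move: symB'; rewrite B'E mulmx_block !mulmx1 !mulmx0 !addr0 !add0r mul0mx.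
rewrite (@tr_block_mx _ 1 n 1 n) => /(@eq_block_mx _ 1 n 1 n).
move=> [_ /(congr1 trmx) B10 _ symB2].
have {}B10 : B1 = 0 by rewrite -[B1]trmxK -trmx0 -B10 !trmxK.
have posG2 (x : 'rV[R]_n) : x != 0 -> 0 < (x *m G2 *m x^T) 0 0.
  move=> x0; have := posG (x *m D); rewrite trmx_mul /G2 !mulmxA; apply.
  by rewrite (mulmx_free_eq0 _ freeD).
have symG2 : G2^T = G2 by rewrite /G2 !trmx_mul trmxK symG mulmxA.
have charB2 : char_poly B2 = \prod_i ('X - (l (lift ord0 i))%:P).
  have cB' : char_poly (B' : 'M[R]_(1 + n)) = ('X - (l ord0)%:P) * char_poly B2.
    rewrite B'E B10 /char_poly; have := char_block_diag_mx ((l ord0)%:M : 'M[R]_1) B2.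
    by move=> ->; rewrite det_ublock det_mx11 !mxE eqxx.
  have := char_poly_conj P0u P0B; rewrite charB big_ord_recl cB' => h.
  by apply/esym; move: h; apply: mulfI; rewrite polyXsubC_eq0.
have [P2 [P2G P2B]] := IH G2 B2 (fun i => l (lift ord0 i)) symG2 posG2 symB2 charB2.
pose Q : 'M[R]_(1 + n) := @block_mx R 1 n 1 n 1%:M 0 0 P2.
have dE : diag_mx (\row_i l i) =
    @block_mx R 1 n 1 n (l ord0)%:M 0 0 (diag_mx (\row_i l (lift ord0 i))).
  have l0 : l (lshift n (0 : 'I_1)) = l ord0 by congr l; exact: val_inj.
  have lS j : l (rshift 1 j) = l (lift ord0 j) by congr l; exact: val_inj.
  apply/matrixP => i j; rewrite [LHS]mxE [X in X *+ _]mxE.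
  case: (@split_ordP 1 n i) => i' ->; case: (@split_ordP 1 n j) => j' ->.
  - apply: etrans _ (esym (@block_mxEul R 1 n 1 n _ _ _ _ i' j')); by rewrite !mxE !ord1 !eqxx l0.
  - apply: etrans _ (esym (@block_mxEur R 1 n 1 n _ _ _ _ i' j')); by rewrite mxE -val_eqE /= ord1.
  - apply: etrans _ (esym (@block_mxEdl R 1 n 1 n _ _ _ _ i' j')); by rewrite mxE -val_eqE /= ord1.
  - apply: etrans _ (esym (@block_mxEdr R 1 n 1 n _ _ _ _ i' j')); by rewrite !mxE -val_eqE /= lS.
exists (Q *m P0); split.
  transitivity (Q *m (P0 *m G *m P0^T) *m Q^T).
    by rewrite (trmx_mul Q P0) !mulmxA.
  rewrite P0G /Q (@tr_block_mx _ 1 n 1 n) !trmx1 !trmx0 !mulmx_block.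
  by rewrite !(mulmx0, mul0mx, mulmx1, mul1mx, addr0, add0r) P2G -scalar_mx_block.
transitivity (Q *m B' *m P0); first by rewrite -[RHS]mulmxA -P0B mulmxA.
rewrite [RHS]mulmxA; congr (_ *m _).
rewrite dE /Q B'E B10 !mulmx_block.
rewrite !(mulmx0, mul0mx, mulmx1, mul1mx, addr0, add0r) P2B.
apply: etrans _ (esym (@mulmx_block R 1 n 1 n 1 n _ _ _ _ _ _ _ _)).
by rewrite !(mulmx0, mul0mx, mulmx1, mul1mx, addr0, add0r).
Qed.

Section discrete_eigenbasis.
Context {R : realType} {E : lmodType R} (a b : E -> E -> R).
Context (ha : semi_inner a) (hb : semi_inner b).
Context (N : nat) (psi : 'I_N -> E) (A : 'M[R]_N) (l : 'I_N -> R).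
Context (psi_free : forall c : 'I_N -> R,
  b (\sum_i c i *: psi i) (\sum_i c i *: psi i) = 0 -> forall i, c i = 0).
Context (psi_op : forall i j, a (psi i) (psi j) = \sum_k A k i * b (psi k) (psi j)).
Context (charA : char_poly A = \prod_i ('X - (l i)%:P)).

(** By [psi_op] the Gram matrix of [a] is A^T G, with G the Gram matrix of [b]. Thus A^T is
    self-adjoint for G, and the rows of the diagonalizing matrix are the coefficients of [e] in
    [psi]. The last clause is what later identifies the L2-projection. *)
Lemma discrete_eigenbasis : exists e : 'I_N -> E,
  [/\ forall i j, b (e i) (e j) = (i == j)%:R,
      forall i j, a (e i) (e j) = l i * (i == j)%:R,
      forall i, exists c, e i = \sum_j c j *: psi j &
      forall c, \sum_j c j *: psi j = \sum_i b (\sum_j c j *: psi j) (e i) *: e i].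
Proof.
pose G : 'M[R]_N := \matrix_(i, j) b (psi i) (psi j).
have form_mx (f : E -> E -> R) (hf : semi_inner f) (P Q : 'M[R]_N) i j :
    f (\sum_k P i k *: psi k) (\sum_m Q j m *: psi m) =
    (P *m (\matrix_(k, m) f (psi k) (psi m)) *m Q^T) i j.
  rewrite (si_sumr hf) mxE; apply: eq_bigr => m _.
  rewrite (siZr hf) (si_suml hf) !mxE mulrC; congr (_ * _).
  by apply: eq_bigr => k _; rewrite (siZl hf) mxE.
have GT : G^T = G by apply/matrixP => i j; rewrite !mxE (semi_innerC hb).
have AG : A^T *m G = \matrix_(i, j) a (psi i) (psi j).
  apply/matrixP => i j; rewrite !mxE psi_op; apply: eq_bigr => k _.
  by rewrite !mxE.
have posG (x : 'rV[R]_N) : x != 0 -> 0 < (x *m G *m x^T) 0 0.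
  move=> x0; pose v := \sum_i x 0 i *: psi i.
  have <- : b v v = (x *m G *m x^T) 0 0.
    rewrite (si_sumr hb) mxE; apply: eq_bigr => m _.
    rewrite (siZr hb) (si_suml hb) !mxE mulrC; congr (_ * _).
    by apply: eq_bigr => k _; rewrite (siZl hb) mxE.
  rewrite lt_neqAle (semi_inner_ge0 hb) andbT eq_sym; apply: contra x0 => /eqP v0.
  by apply/eqP/rowP => i; rewrite (psi_free v0 i) mxE.
have symAG : (A^T *m G)^T = A^T *m G.
  by rewrite AG; apply/matrixP => i j; rewrite !mxE (semi_innerC ha).
have charAT : char_poly A^T = \prod_i ('X - (l i)%:P) by rewrite char_poly_trmx.
have [P [PG PA]] := symmetric_pencil_diag GT posG symAG charAT.
pose e i := \sum_j P i j *: psi j.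
have e_orth i j : b (e i) (e j) = (i == j)%:R.
  by rewrite (form_mx b hb P P) -/G PG mxE.
exists e; split=> //.
- move=> i j; rewrite /e (form_mx a ha P P) -AG.
  have -> : P *m (A^T *m G) *m P^T = diag_mx (\row_i l i).
    by rewrite mulmxA PA -[_ *m P *m G]mulmxA -mulmxA PG mulmx1.
  by rewrite !mxE mulr_natr.
- by move=> i; exists (P i).
move=> c.
have Pu : P \in unitmx by have := mulmx1_unit (etrans (mulmxA _ _ _) PG) => -[].
have [y ->] : exists y : 'I_N -> R, \sum_j c j *: psi j = \sum_i y i *: e i.
  pose x : 'rV[R]_N := \row_j c j; exists (fun i => (x *m invmx P) 0 i).
  under [RHS]eq_bigr do rewrite scaler_sumr.
  rewrite exchange_big /=; apply: eq_bigr => j _.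
  under [RHS]eq_bigr do rewrite scalerA.
  rewrite -scaler_suml; congr (_ *: _).
  have -> : c j = (x *m invmx P *m P) 0 j by rewrite mulmxKV// mxE.
  by rewrite mxE.
by apply: eq_bigr => i _; rewrite (orthonormal_coord hb e_orth).
Qed.

End discrete_eigenbasis.

(** * The Galerkin estimate *)

(** The dimension count of min-max: c is a normalized row of the left kernel of the matrix [f], and
    serves as the coefficients of a unit vector in the span of n orthonormal vectors. *)
Lemma underdetermined_unit_solution {R : rcfType} (m n : nat) (f : 'I_n -> 'I_m -> R) :
  (m < n)%N ->
  exists c : 'I_n -> R, \sum_i c i ^+ 2 = 1 /\ forall j, \sum_i c i * f i j = 0.
Proof.
move=> mn; pose A := \matrix_(i, j) f i j.
have kerA : kermx A != 0.
  by rewrite -mxrank_eq0 mxrank_ker subn_eq0 -ltnNge (leq_ltn_trans (rank_leq_col A)).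
have [i0 Ki0] : exists i, row i (kermx A) != 0.
  apply/existsP; apply: contraR kerA => /existsPn h.
  by apply/eqP/row_matrixP => i; rewrite row0; apply/eqP; have := h i; rewrite negbK.
set x := row i0 _ in Ki0.
have xA : x *m A = 0 by rewrite -row_mul mulmx_ker row0.
pose s := \sum_i x ord0 i ^+ 2.
have s_gt0 : 0 < s.
  rewrite lt_neqAle sumr_ge0 ?andbT => [|i _]; last exact: sqr_ge0.
  apply: contra Ki0; rewrite eq_sym psumr_eq0 => [|i _]; last exact: sqr_ge0.
  move=> /allP h; apply/eqP/rowP => i; rewrite [RHS]mxE.
  by have := h i (mem_index_enum i); rewrite sqrf_eq0 => /eqP.
exists (fun i => (Num.sqrt s)^-1 * x ord0 i); split.
  under eq_bigr do rewrite exprMn exprVn sqr_sqrtr ?(ltW s_gt0)//.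
  by rewrite -mulr_sumr mulVf// gt_eqF.
move=> j; under eq_bigr do rewrite -mulrA.
rewrite -mulr_sumr.
have -> : \sum_i x ord0 i * f i j = (x *m A) ord0 j.
  by rewrite mxE; apply: eq_bigr => i _; rewrite [A _ _]mxE.
by rewrite xA mxE mulr0.
Qed.

Section orthogonal_energy.
Context {R : realType} {E : lmodType R} (a b : E -> E -> R).
Context (ha : semi_inner a) (hb : semi_inner b).
Context (n : nat) (f : 'I_n -> E) (mu : 'I_n -> R).
Context (f_orth : forall i j, b (f i) (f j) = (i == j)%:R).
Context (f_energy : forall i j, a (f i) (f j) = mu i * (i == j)%:R).

Lemma orthogonal_energy (c : 'I_n -> R) :
  a (\sum_i c i *: f i) (\sum_i c i *: f i) = \sum_i mu i * c i ^+ 2.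
Proof.
rewrite (si_suml ha); apply: eq_bigr => i _.
rewrite (siZl ha) (si_sumr ha) (bigD1 i)//= big1 ?addr0 => [|j ji].
  by rewrite (siZr ha) f_energy eqxx mulr1; ring.
by rewrite (siZr ha) f_energy eq_sym (negbTE ji) !mulr0.
Qed.

End orthogonal_energy.

(* Kato's [|I - P| = |P|] in the plane spanned by [x = P v] and [y = v - P v],
   where [X = |x|^2], [Y = |y|^2] and [B] is the product of [x] and [y]: the last
   hypothesis bounds [P] at [x + r y]. *)
Lemma complementary_projection_bound {R : realFieldType} (c X Y B : R) :
  1 <= c -> 0 <= X -> 0 <= Y -> B ^+ 2 <= X * Y ->
  (forall r, X <= c * (X + 2 * r * B + r ^+ 2 * Y)) -> Y <= c * (X + 2 * B + Y).
Proof.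
move=> c1 X0 Y0 BXY h.
(* A sharpened Cauchy-Schwarz inequality: r = - B / Y minimizes the right side of [h] and gives X Y
   <= c (X Y - B^2), which keeps the angle between x and y away from 0. *)
have cB : c * B ^+ 2 <= (c - 1) * (X * Y).
  have [Y_eq0|Yn0] := eqVneq Y 0.
    rewrite Y_eq0 !mulr0 in BXY *; have /eqP -> : B ^+ 2 == 0.
      by rewrite eq_le BXY sqr_ge0.
    by rewrite mulr0.
  have Y_gt0 : 0 < Y by rewrite lt_neqAle eq_sym Yn0.
  have := h (- B / Y).
  have -> : X + 2 * (- B / Y) * B + (- B / Y) ^+ 2 * Y = (X * Y - B ^+ 2) / Y.
    by field.
  by rewrite mulrA ler_pdivlMr// => h1; nra.
have [X_eq0|Xn0] := eqVneq X 0.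
  have -> : B = 0.
    by apply/eqP; rewrite -sqrf_eq0 eq_le sqr_ge0 andbT (le_trans BXY)// X_eq0 mul0r.
  nra.
have X_gt0 : 0 < X by rewrite lt_neqAle eq_sym Xn0.
rewrite -subr_ge0 -(@pmulr_rge0 _ (c * X)) ?mulr_gt0 ?(lt_le_trans ltr01 c1)//.
(* Completing the square leaves exactly the slack of [cB]. *)
have -> : c * X * (c * (X + 2 * B + Y) - Y) =
  c ^+ 2 * (X + B) ^+ 2 + c * ((c - 1) * (X * Y) - c * B ^+ 2) by ring.
have c0 : 0 <= c := le_trans ler01 c1.
by apply: addr_ge0; apply: mulr_ge0; rewrite ?sqr_ge0 ?subr_ge0.
Qed.

Section galerkin_estimate.
Context {R : realType} {E : lmodType R} (a b : E -> E -> R).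
Context (ha : semi_inner a) (hb : semi_inner b).
Context (lam : nat -> R) (phi : nat -> E).
Context (lam_ge0 : forall i, 0 <= lam i).
Context (lam_mono : forall i j, (i <= j)%N -> lam i <= lam j).
Context (phi_orth : forall i j, b (phi i) (phi j) = (i == j)%:R).
Context (phi_eigen : forall i v, a (phi i) v = lam i * b (phi i) v).
Context (N : nat) (e : 'I_N -> E) (l : 'I_N -> R).
Context (e_orth : forall i j, b (e i) (e j) = (i == j)%:R).
Context (e_energy : forall i j, a (e i) (e j) = l i * (i == j)%:R).
Context (l_mono : forall i j : 'I_N, (i <= j)%N -> l i <= l j).

Let Q v := \sum_i b v (e i) *: e i.

Context (c1 K : R) (c1_gt0 : 0 < c1) (K_gt0 : 0 < K).
Context (Q_stable : forall v, a (Q v) (Q v) <= c1 * a v v).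
Context (Q_approx : forall v, b (v - Q v) (v - Q v) <= K * a v v).
Context (k : nat) (lamK : lam k * (2 * K) < 1).
Context (lower : forall v, (forall i, (i < k)%N -> b v (phi i) = 0) ->
  lam k * b v v <= a v v).

Lemma proj_coord v i : b (Q v) (e i) = b v (e i).
Proof. exact: (orthonormal_coord hb e_orth). Qed.

Lemma proj_orth v : b (v - Q v) (Q v) = 0.
Proof.
rewrite (si_sumr hb) big1// => i _.
by rewrite (siZr hb) (siDl hb) (siNl hb) proj_coord subrr mulr0.
Qed.

Lemma proj_pythagoras v : b v v = b (Q v) (Q v) + b (v - Q v) (v - Q v).
Proof.
transitivity (b (Q v + (v - Q v)) (Q v + (v - Q v))).
  by rewrite [Q v + _]addrC subrK.
by rewrite (si_sqrD hb (Q v) (v - Q v)) (semi_innerC hb (Q v) (v - Q v)) proj_orth mulr0 addr0.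
Qed.

(** Allows the stability of [Q] to be used along the whole line through Q v in the direction v - Q
    v, as the bound for the complementary projection demands. *)
Lemma proj_span v r : Q (Q v + r *: (v - Q v)) = Q v.
Proof.
apply: eq_bigr => i _; congr (_ *: _).
by rewrite (siDl hb) (siZl hb) (siDl hb) (siNl hb) proj_coord subrr mulr0 addr0.
Qed.

Lemma proj_compl0 v : Q (v - Q v) = 0.
Proof.
by apply: big1 => i _; rewrite (siDl hb) (siNl hb) proj_coord subrr scale0r.
Qed.

(** Stability at Q v, which [Q] fixes, reads a (Q v) (Q v) <= c1 * a (Q v) (Q v). The constant c1 is
    only assumed positive, so the degenerate alternative has to be kept. *)
Lemma proj_energy_dichotomy v : a (Q v) (Q v) = 0 \/ 1 <= c1.
Proof.
have [->|Qv0] := eqVneq (a (Q v) (Q v)) 0; [by left|right].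
have Qv_gt0 : 0 < a (Q v) (Q v) by rewrite lt_neqAle eq_sym Qv0 (semi_inner_ge0 ha).
have := Q_stable (Q v); have := proj_span v 0; rewrite scale0r addr0 => ->.
by rewrite -[X in X <= _]mul1r ler_pM2r.
Qed.

(** The constant is the one for [Q]; the triangle inequality would only give (1 + sqrt c1)^2 and
    spoil the term c1 / 2 of the final constant. *)
Lemma compl_stable v : 1 <= c1 -> a (v - Q v) (v - Q v) <= c1 * a v v.
Proof.
move=> c1_ge1; have -> : a v v = a (Q v) (Q v) + 2 * a (Q v) (v - Q v) +
    a (v - Q v) (v - Q v).
  by rewrite -(si_sqrD ha) addrC subrK.
apply: complementary_projection_bound => //; try exact: (semi_inner_ge0 ha).
  exact: si_CauchySchwarz.
move=> r; have := Q_stable (Q v + r *: (v - Q v)); rewrite proj_span.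
by rewrite (si_sqrD ha (Q v) (r *: (v - Q v))) !(siZr ha) (siZl ha) mulrA mulrA -expr2.
Qed.

Lemma phi_energy i j : a (phi i) (phi j) = lam i * (i == j)%:R.
Proof. by rewrite phi_eigen phi_orth. Qed.

Lemma W_norm (c : 'I_k.+1 -> R) : let w := \sum_i c i *: phi i in
  b w w = \sum_i c i ^+ 2.
Proof. by move=> w; apply: (orthonormal_norm hb (e := fun i : 'I_k.+1 => phi i)) => i j; exact: phi_orth. Qed.

Lemma W_energy (c : 'I_k.+1 -> R) : let w := \sum_i c i *: phi i in
  a w w <= lam k * b w w.
Proof.
rewrite /= W_norm; rewrite (orthogonal_energy ha (f := fun i : 'I_k.+1 => phi i)
    (mu := fun i => lam i)); last by move=> i j; exact: phi_energy.
rewrite mulr_sumr; apply: ler_sum => i _; apply: ler_wpM2r; first exact: sqr_ge0.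
by apply: lam_mono; rewrite -ltnS.
Qed.

Lemma W_proj_defect (c : 'I_k.+1 -> R) : let w := \sum_i c i *: phi i in
  b w w = 1 -> b (w - Q w) (w - Q w) < 1 / 2.
Proof.
move=> w w1; apply: le_lt_trans (Q_approx w) _.
have /= := W_energy c; rewrite -/w w1 mulr1 => aw.
have := ler_wpM2l (ltW K_gt0) aw; move: lamK => lamK'; nra.
Qed.

(** Otherwise some unit vector in the span of [phi 0], ..., [phi k] is orthogonal to every [e j];
    its projection is 0, so its squared defect is 1 and not below 1 / 2. *)
Lemma galerkin_dim : (k < N)%N.
Proof.
rewrite ltnNge; apply/negP => Nk.
have [c [c1' hc]] := underdetermined_unit_solution
  (fun (i : 'I_k.+1) (j : 'I_N) => b (phi i) (e j)) (Nk : (N < k.+1)%N).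
pose w := \sum_i c i *: phi i.
have w1 : b w w = 1 by rewrite W_norm.
have Qw : Q w = 0.
  apply: big1 => j _; rewrite (si_suml hb).
  by under eq_bigr do rewrite (siZl hb); rewrite hc scale0r.
by have := W_proj_defect w1; rewrite -/w Qw subr0 w1; lra.
Qed.

Let kN : 'I_N := Ordinal galerkin_dim.

(** In the span of the first k + 1 discrete eigenvectors there is a unit vector orthogonal to every
    [phi j] with j < k. Its energy is at least [lam k] by [lower] and at most [l kN] by the diagonal
    form of [a]. *)
Lemma galerkin_lower : lam k <= l kN.
Proof.
pose wi (i : 'I_k.+1) : 'I_N := widen_ord galerkin_dim i.
have wi_inj i j : (wi i == wi j) = (i == j) by [].
have [c [c1' hc]] := underdetermined_unit_solution
  (fun (i : 'I_k.+1) (j : 'I_k) => b (e (wi i)) (phi j)) (ltnSn k).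
pose v := \sum_i c i *: e (wi i).
have v1 : b v v = 1.
  by rewrite (orthonormal_norm hb (e := fun i => e (wi i)))// => i j; rewrite e_orth.
have := lower (v := v); rewrite v1 mulr1 => /(_ _)/le_trans; apply.
  move=> j jk; rewrite (si_suml hb); under eq_bigr do rewrite (siZl hb).
  exact: (hc (Ordinal jk)).
rewrite (orthogonal_energy ha (f := fun i => e (wi i)) (mu := fun i => l (wi i))).
  rewrite -[leRHS]mulr1 -c1' mulr_sumr; apply: ler_sum => i _.
  by apply: ler_wpM2r; [exact: sqr_ge0|apply: l_mono; rewrite /= -ltnS].
by move=> i j; rewrite e_energy.
Qed.

Lemma galerkin_upper : exists c : 'I_k.+1 -> R, let w := \sum_i c i *: phi i in
  b w w = 1 /\ Num.sqrt (l kN) <=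
    Num.sqrt (lam k) + (1 + c1 / 2) * Num.sqrt (a (w - Q w) (w - Q w)).
Proof.
pose wi (j : 'I_k) : 'I_N := widen_ord (ltnW galerkin_dim) j.
have [c [c1' hc]] := underdetermined_unit_solution
  (fun (i : 'I_k.+1) (j : 'I_k) => b (phi i) (e (wi j))) (ltnSn k).
exists c => w; have w1 : b w w = 1 by rewrite W_norm.
split=> //.
have we (i : 'I_N) : (i < k)%N -> b w (e i) = 0.
  move=> ik; rewrite (si_suml hb); under eq_bigr do rewrite (siZl hb).
  by have -> : i = wi (Ordinal ik) by [exact: val_inj]; exact: hc.
have lQ : l kN * b (Q w) (Q w) <= a (Q w) (Q w).
  rewrite (orthonormal_norm hb e_orth) (orthogonal_energy ha e_energy) mulr_sumr.
  apply: ler_sum => i _; have [ik|ki] := ltnP i k; first by rewrite we// expr0n !mulr0.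
  by apply: ler_wpM2r; [exact: sqr_ge0|exact: l_mono].
set t := b (w - Q w) (w - Q w).
set s := Num.sqrt (a (w - Q w) (w - Q w)).
set r := Num.sqrt (a (Q w) (Q w)).
have s_ge0 : 0 <= s := sqrtr_ge0 _.
have r_ge0 : 0 <= r := sqrtr_ge0 _.
have s2 : s ^+ 2 = a (w - Q w) (w - Q w) by rewrite sqr_sqrtr// (semi_inner_ge0 ha).
have r2 : r ^+ 2 = a (Q w) (Q w) by rewrite sqr_sqrtr// (semi_inner_ge0 ha).
have t_ge0 : 0 <= t := semi_inner_ge0 hb _.
have t_lt : t < 1 / 2 := W_proj_defect w1.
have bQ : b (Q w) (Q w) = 1 - t by rewrite -w1 (proj_pythagoras w) addrK.
(* The approximation property is applied to w - Q w, whose projection is 0, instead of w: t is then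
   controlled by the energy of the defect, the quantity allowed in the final bound. *)
have tK : t <= K * s ^+ 2.
  by rewrite s2; have := Q_approx (w - Q w); rewrite proj_compl0 subr0.
have aw : a w w <= lam k by have /= := W_energy c; rewrite -/w w1 mulr1.
have l_ge0 : 0 <= l kN := le_trans (lam_ge0 k) galerkin_lower.
have step1 : Num.sqrt (l kN) <= (1 + t) * r.
  rewrite -[leRHS]ger0_norm -?sqrtr_sqr ?mulr_ge0 ?addr_ge0//.
  rewrite ler_sqrt ?sqr_ge0// exprMn r2; rewrite bQ in lQ.
  (* Equivalently 1 / sqrt (1 - t) <= 1 + t; it holds because t + t^2 <= 1 for t < 1 / 2. *)
  have t1 : 1 <= (1 + t) ^+ 2 * (1 - t).
    have -> : (1 + t) ^+ 2 * (1 - t) = 1 + t * (1 - t - t ^+ 2) by ring.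
    by rewrite lerDl mulr_ge0//; nra.
  apply: le_trans (ler_wpM2l (sqr_ge0 (1 + t)) lQ).
  by rewrite mulrCA -[leLHS]mulr1 ler_wpM2l.
have step2 : r <= Num.sqrt (lam k) + s.
  have -> : r = Num.sqrt (a (w - (w - Q w)) (w - (w - Q w))) by rewrite subKr.
  apply: le_trans (si_triangle ha _ _) _.
  by rewrite (siNl ha) (siNr ha) opprK lerD2r ler_sqrt.
(* If r is not 0, then t r <= (K s r) s by [tK]. Both s^2 and r^2 are at most c1 lam_k, hence so is
   s r, and K lam_k < 1 / 2. *)
have step3 : t * r <= c1 / 2 * s.
  have [aQ0|c1_ge1] := proj_energy_dichotomy w.
    by rewrite /r aQ0 sqrtr0 mulr0 mulr_ge0// divr_ge0 ?ltW.
  have sB : s ^+ 2 <= c1 * lam k.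
    rewrite s2; apply: le_trans (compl_stable _ c1_ge1) _.
    by rewrite ler_pM2l.
  have rB : r ^+ 2 <= c1 * lam k.
    by rewrite r2; apply: le_trans (Q_stable _) _; rewrite ler_pM2l.
  have srB : s * r <= c1 * lam k by nra.
  apply: (@le_trans _ _ (K * (s * r) * s)).
    by have := ler_wpM2r r_ge0 tK; congr (_ <= _); ring.
  apply: ler_wpM2r => //.
  have := ler_wpM2l (ltW K_gt0) srB; have := ltW lamK => h1 /le_trans; apply.
  have := ler_wpM2l (ltW c1_gt0) h1; lra.
lra.
Qed.

(** A crude bound, uniform over unit vectors: it makes the set under the [sup] of the theorem
    bounded above, so that [sup] dominates its elements. *)
Lemma galerkin_defect_bounded (c : 'I_k.+1 -> R) : let w := \sum_i c i *: phi i in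
  b w w = 1 -> Num.sqrt (a (w - Q w) (w - Q w)) <=
    Num.sqrt (lam k) + Num.sqrt (c1 * lam k).
Proof.
move=> w w1; apply: le_trans (si_triangle ha _ _) _.
have aw : a w w <= lam k by have /= := W_energy c; rewrite -/w w1 mulr1.
rewrite (siNl ha) (siNr ha) opprK lerD// ler_sqrt ?mulr_ge0 ?(ltW c1_gt0)//.
by apply: le_trans (Q_stable _) _; rewrite ler_pM2l.
Qed.

End galerkin_estimate.

(** * Caratheodory measurability of half-spaces and open sets *)

Section method_one_bounds.
Context {R : realType} {T : pointedType} (tau : set T -> \bar R).

Lemma cover_outer_le (A : set T) (F : nat -> set T) :
  A `<=` \bigcup_k F k -> (cover_outer tau A <= \sum_(k <oo) tau (F k))%E.
Proof.
move=> AF; apply: ereal_inf_lbound; exists F => //; split=> // i.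
exact: sub_sigma_algebra.
Qed.

Lemma cover_outer_ge (A : set T) (x : \bar R) :
  (forall F : nat -> set T, A `<=` \bigcup_k F k -> x <= \sum_(k <oo) tau (F k))%E ->
  (x <= cover_outer tau A)%E.
Proof. by move=> h; apply: le_ereal_inf_tmp => _ [F [_ AF] <-]; exact: h. Qed.

End method_one_bounds.

Lemma ereal_sup_add_le {R : realType} (S1 S2 : set (\bar R)) (z : \bar R) :
  S1 !=set0 -> S2 !=set0 -> (forall x, S1 x -> (0 <= x)%E) ->
  (forall x, S2 x -> (0 <= x)%E) ->
  (forall x y, S1 x -> S2 y -> x + y <= z)%E ->
  (ereal_sup S1 + ereal_sup S2 <= z)%E.
Proof.
move=> [x1 Sx1] [x2 Sx2] S1_ge0 S2_ge0 h.
have z_ge0 : (0 <= z)%E.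
  by apply: le_trans (h _ _ Sx1 Sx2); apply: adde_ge0; [exact: S1_ge0|exact: S2_ge0].
have [->|zoo] := eqVneq z +oo%E; first exact: leey.
have zfin : z \is a fin_num by rewrite ge0_fin_numE// ltey.
have fin x : (0 <= x)%E -> (x <= z)%E -> x \is a fin_num.
  by move=> x0 xz; rewrite ge0_fin_numE// (le_lt_trans xz)// ltey.
have le_z1 x : S1 x -> (x <= z)%E.
  by move=> Sx; apply: le_trans (h _ _ Sx Sx2); apply: leeDl; exact: S2_ge0.
have le_z2 x : S2 x -> (x <= z)%E.
  by move=> Sx; apply: le_trans (h _ _ Sx1 Sx); apply: leeDr; exact: S1_ge0.
have s2 : ereal_sup S2 \is a fin_num.
  apply: fin; first exact: le_trans (S2_ge0 _ Sx2) (ereal_sup_ubound Sx2).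
  exact: ge_ereal_sup.
rewrite -leeBrDr//; apply: ge_ereal_sup => x Sx; rewrite leeBrDr//.
have xfin : x \is a fin_num by apply: fin; [exact: S1_ge0|exact: le_z1].
rewrite addeC -leeBrDr//; apply: ge_ereal_sup => y Sy.
by rewrite leeBrDr// addeC h.
Qed.

(* Caratheodory's criterion: [mu] is additive on sets separated by a gap in the
   values of [g]. The layers [1/(j+2) <= g - c < 1/(j+1)] of equal parity are
   mutually separated, hence have a convergent sum of measures. *)
Section gap_additive.
Context {R : realType} {T : Type} (mu : {outer_measure set T -> \bar R}) (g : T -> R).
Context (gap_additive : forall (A B : set T) s t, s < t ->
  (forall x, A x -> g x <= s) -> (forall x, B x -> t <= g x) ->
  (mu A + mu B <= mu (A `|` B))%E).
Context (c : R) (X : set T).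

Let r (j : nat) : R := j.+1%:R^-1.
Let far j : set T := [set x | X x /\ c + r j <= g x].
Let layer j : set T := [set x | X x /\ c + r j.+1 <= g x < c + r j].

Let r_gt0 j : 0 < r j. Proof. by rewrite invr_gt0. Qed.

Let r_lt i j : (i < j)%N -> r j < r i.
Proof. by move=> ij; rewrite ltf_pV2 ?posrE// ltr_nat. Qed.

Let r_le i j : (i <= j)%N -> r j <= r i.
Proof. by move=> ij; rewrite lef_pV2 ?posrE// ler_nat. Qed.

Let layers_parity (p m : nat) :
  (\sum_(i < m) mu (layer (i.*2 + p)) <= mu X)%E.
Proof.
case: m => [|m]; first by rewrite big_ord0 outer_measure_ge0.
have sub : far (m.*2 + p).+1 `<=` X by move=> x [].
apply: le_trans (le_outer_measure mu _ _ sub).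
elim: m {sub} => [|m IH].
  by rewrite big_ord1; apply: le_outer_measure => x [Xx /andP[]].
rewrite big_ord_recr /= addeC; apply: le_trans (leeD (lexx _) IH) _.
have gap : c + r (m.+1.*2 + p) < c + r (m.*2 + p).+1.
  by rewrite ltrD2l r_lt// doubleS.
apply: le_trans (gap_additive gap _ _) _ => [x [_ /andP[_ /ltW]]//|x []//|].
apply: le_outer_measure => x [[Xx /andP[gx _]]|[Xx gx]]; split=> //.
by apply: le_trans gx; rewrite lerD2l r_le// doubleS ltnW.
Qed.

Let layers_summable m : (\sum_(0 <= i < m) mu (layer i) <= mu X + mu X)%E.
Proof.
have h k : (\sum_(0 <= i < k.*2) mu (layer i) =
    \sum_(i < k) mu (layer (i.*2 + 0)) + \sum_(i < k) mu (layer (i.*2 + 1)))%E.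
  elim: k => [|k IH]; first by rewrite big_nil !big_ord0 adde0.
  rewrite doubleS !big_nat_recr//= IH !big_ord_recr/= addn0 addn1.
  by rewrite -addeA addeACA.
apply: (@le_trans _ _ (\sum_(0 <= i < m.*2) mu (layer i))%E).
  apply: (ereal_nondecreasing_series (u_ := fun i => mu (layer i)) (P := xpredT)).
    by move=> i _ _; exact: outer_measure_ge0.
  by rewrite -addnn leq_addr.
by rewrite h leeD.
Qed.

Lemma gap_additive_le :
  (mu (X `&` [set x | (g x <= c)%R]) + mu (X `&` ~` [set x | (g x <= c)%R]) <= mu X)%E.
Proof.
have [->|Xoo] := eqVneq (mu X) +oo%E; first exact: leey.
have Xfin : mu X \is a fin_num by rewrite ge0_fin_numE ?outer_measure_ge0// ltey.
have far_le j : (mu (X `&` [set x | (g x <= c)%R]) + mu (far j) <= mu X)%E.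
  have gap : c < c + r j by rewrite ltrDl.
  apply: le_trans (gap_additive gap _ _) _ => [x []//|x []//|].
  by apply: le_outer_measure => x [[]|[]].
(* Partial sums of the layer measures stay below 2 mu X, which is finite here, so the tails tend to
   0. *)
have tail_cvg : (\sum_(N <= i <oo) mu (layer i) @[N --> \oo] --> 0)%E.
  apply: nneseries_tail_cvg => [|i _]; last exact: outer_measure_ge0.
  apply: (@le_lt_trans _ _ (mu X + mu X)%E); last by rewrite ltey_eq fin_numD Xfin.
  apply: lime_le; last by near=> m; exact: layers_summable.
  by apply: is_cvg_nneseries => i _ _; exact: outer_measure_ge0.
have far_cover j : X `&` ~` [set x | g x <= c] `<=`
    far j `|` \bigcup_(i in ~` `I_j) layer i.
  move=> x [Xx /negP]; rewrite -ltNge => gx.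
  have [|gxj] := leP (c + r j) (g x); first by left.
  right.
  have [m hm] : exists m, c + r m <= g x.
    exists (Num.bound (g x - c)^-1); rewrite -lerBrDl /r -[leRHS]invrK lef_pV2 ?posrE ?invr_gt0 ?subr_gt0//.
    apply: ltW; apply: lt_trans (archi_boundP _) _; last by rewrite ltr_nat.
    by rewrite invr_ge0 subr_ge0 ltW.
  have ex : exists m, c + r m <= g x by exists m.
  case: (ex_minnP ex) => -[|k] hk kmin.
    by exfalso; move: gxj; rewrite ltNge => /negP; apply; apply: le_trans hk; rewrite lerD2l r_le.
  have gk : g x < c + r k.
    by rewrite ltNge; apply/negP => /kmin; rewrite ltnn.
  exists k; last by split=> //; rewrite hk gk.
  move=> /= kj.
  by have := le_lt_trans hk gxj; rewrite ltrD2l ltNge r_le.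
(* The part of [X] above c consists of [far j] and of layers of index at least j; only the latter
   contribute an error. *)
have bound j : (mu (X `&` [set x | (g x <= c)%R]) +
    mu (X `&` ~` [set x | (g x <= c)%R]) <= mu X + \sum_(j <= i <oo) mu (layer i))%E.
  apply: le_trans (leeD (far_le j) (outer_measure_sigma_subadditive_tail mu j layer)).
  rewrite -addeA leeD2l//; apply: le_trans (le_outer_measure mu _ _ (far_cover j)) _.
  exact: outer_measureU2.
have lim_bound : (mu X + \sum_(j <= i <oo) mu (layer i) @[j --> \oo] --> mu X + 0)%E.
  apply: cvgeD => //; first by rewrite fin_num_adde_defl.
  exact: cvg_cst.
rewrite -[leRHS]adde0; apply: (cvge_to_ge lim_bound).
by near=> j; exact: bound.
Unshelve. all: by end_near. Qed.

End gap_additive.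

Section borel_caratheodory.
Context {R : realType} {n : nat} (mu : {outer_measure set 'rV[R]_n.+1 -> \bar R}).
Local Notation Rd := 'rV[R]_n.+1.
Context (half_space : forall i c, mu.-caratheodory [set x : Rd | x 0 i <= c]).
Local Notation T := (caratheodory_type mu).

Let box (ab : 'rV[rat]_n.+1 * 'rV[rat]_n.+1) : set Rd :=
  [set x | forall i, ratr (ab.1 0 i) < x 0 i <= ratr (ab.2 0 i)].

Let measurable_box ab : measurable (box ab : set T).
Proof.
have -> : box ab = \bigcap_(i in [set: 'I_n.+1])
    ([set x : Rd | x 0 i <= ratr (ab.2 0 i)] `\` [set x | x 0 i <= ratr (ab.1 0 i)]).
  apply/seteqP; split=> x /= h i.
    by have /andP[h1 h2] := h i; move=> _; split=> //; apply/negP; rewrite -ltNge.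
  by have [h1 /negP] := h i Logic.I; rewrite -ltNge h1 andbT.
apply: fin_bigcap_measurable => // i _.
by apply: measurableD; exact: half_space.
Qed.

(** An open set is the union of the countably many half-open rational boxes inside it, and such a
    box is a finite intersection of differences of half-spaces. *)
Lemma open_caratheodory (U : set Rd) : open U -> measurable (U : set T).
Proof.
move=> oU.
have -> : U = \bigcup_ab (if `[<box ab `<=` U>] then box ab else set0).
  apply/seteqP; split=> [x Ux|x [ab _]]; last by case: asboolP => // h /h.
  have /nbhs_ballP[e /= e0 he] : nbhs x U by apply: open_nbhs_nbhs.
  have /choice[a ha] : forall i, exists q : rat, x 0 i - e < ratr q < x 0 i.
    move=> i; have [|q] := @rat_in_itvoo R (x 0 i - e) (x 0 i); first by rewrite ltrBlDr ltrDl.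
    by rewrite in_itv /=; exists q.
  have /choice[b hb] : forall i, exists q : rat, x 0 i < ratr q < x 0 i + e.
    move=> i; have [|q] := @rat_in_itvoo R (x 0 i) (x 0 i + e); first by rewrite ltrDl.
    by rewrite in_itv /=; exists q.
  exists (\row_i a i, \row_i b i) => //; rewrite asboolT.
    move=> i /=; rewrite !mxE; have := ha i; have := hb i; lra.
  move=> y By; apply: he; split=> // i j; rewrite ord1; have := By j.
  rewrite /= !mxE /ball /= ltr_distl; have := ha j; have := hb j; lra.
apply: countable_bigcupT_measurable; first exact: countableP.
by move=> ab; case: asboolP.
Qed.

Lemma continuous_caratheodory (f : Rd -> R) (D : set T) :
  continuous f -> measurable_fun D (f : T -> R).
Proof.
move=> cf; apply: (@measurable_funS _ _ _ _ setT) => //.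
apply: (measurability _ (measurable_realfun.RGenOpens.measurableE R)) => _ [_ [a [b ->]] <-].
rewrite setTI; apply: open_caratheodory; move/continuousP : cf; apply.
exact: interval_open.
Qed.

End borel_caratheodory.

Section lebesgue_half_space.
Context {R : realType} {n : nat}.
Local Notation Rd := 'rV[R]_n.+1.

Lemma vol_box_le (a b : Rd) : (vol (box (a, b)) <= (box_vol (a, b))%:E)%E.
Proof. by apply: ereal_inf_lbound; exists (a, b). Qed.

(** Both pieces keep the common face: [vol] is +oo off the closed boxes, and a box cut by a strict
    inequality is in general not closed. *)
Lemma vol_split (F : set Rd) i c :
  (vol (F `&` [set x | (x 0 i <= c)%R]) + vol (F `&` [set x | (c <= x 0 i)%R]) <= vol F)%E.
Proof.
apply: le_ereal_inf_tmp => _ [[a b] <- <-].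
pose b1 : Rd := \row_j if j == i then Num.min (b 0 i) c else b 0 j.
pose a2 : Rd := \row_j if j == i then Num.max (a 0 i) c else a 0 j.
have -> : box (a, b) `&` [set x | x 0 i <= c] = box (a, b1).
  apply/seteqP; split=> [x [/= h xc] j|x /= h].
    rewrite /= mxE; have := h j; case: eqVneq => [->|//].
    by rewrite le_min xc andbT.
  split=> [j|]; last first.
    by have := h i; rewrite mxE eqxx le_min => /and3P[].
  have := h j; rewrite mxE; case: eqVneq => [->|//].
  by rewrite le_min => /and3P[-> ->].
have -> : box (a, b) `&` [set x | c <= x 0 i] = box (a2, b).
  apply/seteqP; split=> [x [/= h xc] j|x /= h].
    rewrite /= mxE; have := h j; case: eqVneq => [->|//].
    by rewrite ge_max xc andbT.
  split=> [j|]; last first.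
    by have := h i; rewrite mxE eqxx ge_max => /andP[/andP[]].
  have := h j; rewrite mxE; case: eqVneq => [->|//].
  by rewrite ge_max => /andP[/andP[-> _] ->].
apply: le_trans (leeD (vol_box_le _ _) (vol_box_le _ _)) _.
rewrite -EFinD lee_fin /box_vol /=.
rewrite (bigD1 i)// [X in _ + X](bigD1 i)//= [leRHS](bigD1 i)//= !mxE eqxx.
have -> : \prod_(j < n.+1 | j != i) Num.max 0 (b1 0 j - a 0 j) =
    \prod_(j < n.+1 | j != i) Num.max 0 (b 0 j - a 0 j).
  by apply: eq_bigr => j /negbTE ji; rewrite mxE ji.
have -> : \prod_(j < n.+1 | j != i) Num.max 0 (b 0 j - a2 0 j) =
    \prod_(j < n.+1 | j != i) Num.max 0 (b 0 j - a 0 j).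
  by apply: eq_bigr => j /negbTE ji; rewrite mxE ji.
rewrite -mulrDl ler_wpM2r//.
  by apply: prodr_ge0 => j _; rewrite le_max lexx.
(* Compares side lengths in direction i, including the cases of an empty box and of a cut c that
   misses the box. *)
by rewrite /Num.max /Num.min; repeat case: ifPn; rewrite -?leNgt; lra.
Qed.

Lemma leb_half_space i c :
  (leb_outer R n).-caratheodory [set x : Rd | x 0 i <= c].
Proof.
apply: le_caratheodory_measurable => X; apply: cover_outer_ge => F XF.
set H := [set x : Rd | x 0 i <= c].
apply: (@le_trans _ _ (\sum_(k <oo) (vol (F k `&` H) +
    vol (F k `&` [set x | (c <= x 0 i)%R])))%E); last first.
  apply: lee_nneseries => [k _ _|k _]; first by apply: adde_ge0; exact: vol_ge0.
  exact: vol_split.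
rewrite nneseriesD => [|k _ _|k _ _]; try exact: vol_ge0.
apply: leeD; apply: cover_outer_le => x [/XF[k _ Fk] Hx]; exists k => //; split=> //.
by apply/ltW; rewrite ltNge; apply/negP.
Qed.

End lebesgue_half_space.

Section hausdorff_half_space.
Context {R : realType} {n : nat}.
Local Notation Rd := 'rV[R]_n.+1.

Lemma coord_le_enorm (x : Rd) i : `|x 0 i| <= enorm x.
Proof.
rewrite -sqrtr_sqr ler_sqrt; last first.
  by rewrite /dotv mxE sumr_ge0// => j _; rewrite mxE -expr2 sqr_ge0.
rewrite /dotv mxE (bigD1 i)//= mxE expr2 lerDl sumr_ge0// => j _.
by rewrite mxE -expr2 sqr_ge0.
Qed.

Lemma hgauge_anti s d1 d2 (A : set Rd) : d1 <= d2 ->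
  (hgauge s d2 A <= hgauge s d1 A)%E.
Proof.
move=> d12; rewrite /hgauge; case: ifPn => // _; case: ifPn => [h2|h2]; last first.
  by rewrite ifF ?leey//; apply: contraNF h2 => /le_trans; apply; rewrite lee_fin.
by case: ifPn => // _; exact: leey.
Qed.

(** Once delta is below the gap t2 - t1, a set meeting both [A] and [B] has infinite gauge, so a
    cover of the union of finite total gauge splits into separate covers of [A] and [B]. *)
Lemma hausdorff_gap s i (A B : set Rd) t1 t2 : t1 < t2 ->
  (forall x, A x -> x 0 i <= t1) -> (forall x, B x -> t2 <= x 0 i) ->
  (hausdorff_star s A + hausdorff_star s B <= hausdorff_star s (A `|` B))%E.
Proof.
move=> t12 hA hB.
have ge0 (d : R) (C : set Rd) : (0 <= cover_outer (hgauge s d) C)%E.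
  by case: (cover_outer_isOuter (@hgauge0 R n s d) (@hgauge_ge0 R n s d)).
apply: ereal_sup_add_le.
- by exists (cover_outer (hgauge s 1) A); exists 1 => //=; exact: ltr01.
- by exists (cover_outer (hgauge s 1) B); exists 1 => //=; exact: ltr01.
- by move=> _ [d _ <-]; exact: ge0.
- by move=> _ [d _ <-]; exact: ge0.
move=> _ _ [d1 d1_gt0 <-] [d2 d2_gt0 <-].
(* Less than the gap, and at most d1 and d2 because a smaller delta only increases the gauge. *)
pose d := Num.min (Num.min d1 d2) ((t2 - t1) / 2).
have d_gt0 : 0 < d by rewrite !lt_min d1_gt0 d2_gt0 divr_gt0 ?subr_gt0.
have [dd1 dd2] : d <= d1 /\ d <= d2 by rewrite !ge_min !lexx !orbT.
have dt : d < t2 - t1.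
  by apply: (@le_lt_trans _ _ ((t2 - t1) / 2)); [rewrite ge_min lexx orbT|lra].
apply: le_trans (ereal_sup_ubound _); last by exists d.
apply: cover_outer_ge => F ABF.
pose G (P : set Rd) k := if `[<F k `&` P !=set0>] then F k else set0.
have GP P k : (0 <= hgauge s d (G P k))%E by exact: hgauge_ge0.
apply: (@le_trans _ _ (\sum_(k <oo) (hgauge s d (G A k) + hgauge s d (G B k)))%E); last first.
  apply: lee_nneseries => [k _ _|k _]; first exact: adde_ge0.
  rewrite /G; case: asboolP => [[x [Fx Ax]]|_]; last first.
    by rewrite hgauge0 add0e; case: asboolP => // _; rewrite hgauge0 hgauge_ge0.
  case: asboolP => [[y [Fy By]]|_]; last by rewrite hgauge0 adde0.
  rewrite /hgauge ifF; last by apply/negP => /eqP F0; rewrite F0 in Fx.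
  rewrite ifF ?leey//; apply/negP => h.
  have : ((enorm (y - x))%:E <= d%:E)%E by apply: le_trans h; apply: ereal_sup_ubound; exists (y, x).
  rewrite lee_fin leNgt => /negP; apply; apply: lt_le_trans dt _.
  apply: le_trans (coord_le_enorm _ i); apply: le_trans (ler_norm _).
  by rewrite !mxE lerB ?hA ?hB.
rewrite nneseriesD//; apply: leeD.
  apply: (@le_trans _ _ (\sum_(k <oo) hgauge s d1 (G A k))%E).
    apply: cover_outer_le => x Ax; have [k _ Fx] := ABF x (or_introl Ax); exists k => //.
    by rewrite /G asboolT//; exists x.
  by apply: lee_nneseries => [k _ _|k _]; [exact: hgauge_ge0|exact: hgauge_anti].
apply: (@le_trans _ _ (\sum_(k <oo) hgauge s d2 (G B k))%E).
  apply: cover_outer_le => x Bx; have [k _ Fx] := ABF x (or_intror Bx); exists k => //.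
  by rewrite /G asboolT//; exists x.
by apply: lee_nneseries => [k _ _|k _]; [exact: hgauge_ge0|exact: hgauge_anti].
Qed.

Lemma hausdorff_half_space s i c :
  (hausdorff_outer R n s).-caratheodory [set x : Rd | x 0 i <= c].
Proof.
apply: le_caratheodory_measurable => X.
by apply: (gap_additive_le (g := fun x : Rd => x 0 i)); exact: hausdorff_gap.
Qed.

End hausdorff_half_space.

(** * Square-integrable functions *)

Section square_integrable.
Context d (T : measurableType d) (R : realType) (mu : {measure set T -> \bar R}).
Context (D : set T) (mD : measurable D).
Implicit Types f g : T -> R.

Definition sq_integrable f : Prop :=
  measurable_fun D f /\ mu.-integrable D (fun x => ((f x) ^+ 2)%:E).

Lemma measurable_sqr f : measurable_fun D f ->
  measurable_fun D (fun x => ((f x) ^+ 2)%:E).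
Proof. by move=> mf; apply/measurable_EFinP; exact: measurable_funX. Qed.

Lemma sq_integrableP f : measurable_fun D f ->
  (\int[mu]_(x in D) ((f x) ^+ 2)%:E < +oo)%E -> sq_integrable f.
Proof.
move=> mf fi; split=> //; apply/integrableP; split; first exact: measurable_sqr.
by under eq_integral do rewrite gee0_abs ?lee_fin ?sqr_ge0//.
Qed.

Lemma integral_sqrE f : sq_integrable f ->
  (\int[mu]_(x in D) (f x ^+ 2))%:E = (\int[mu]_(x in D) ((f x) ^+ 2)%:E)%E.
Proof. by move=> [_ fi]; rewrite fineK//; exact: integrable_fin_num. Qed.

Lemma sq_integrable_mul f g : sq_integrable f -> sq_integrable g ->
  mu.-integrable D (EFin \o (fun x => f x * g x)).
Proof.
move=> [mf fi] [mg gi].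
apply: (le_integrable mD (g := fun x => ((f x) ^+ 2)%:E + ((g x) ^+ 2)%:E)%E).
- by apply/measurable_EFinP; exact: measurable_funM.
- move=> x _; rewrite -EFinD /= lee_fin [leRHS]ger0_norm ?addr_ge0 ?sqr_ge0//.
  by rewrite ler_norml; nra.
- exact: integrableD.
Qed.

Lemma sq_integrable_lin c f g : sq_integrable f -> sq_integrable g ->
  sq_integrable (fun x => c * f x + g x).
Proof.
move=> [mf fi] [mg gi].
have mfg : measurable_fun D (fun x => c * f x + g x).
  by apply: measurable_funD => //; apply: measurable_funM => //; exact: measurable_cst.
split=> //.
have i2 : mu.-integrable D (fun x => (2 * c ^+ 2)%:E * ((f x) ^+ 2)%:E +
    2%:E * ((g x) ^+ 2)%:E)%E.
  by apply: integrableD => //; exact: integrableZl.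
apply: (le_integrable mD _ _ i2); first exact: measurable_sqr.
move=> x _; rewrite -!EFinM -EFinD /= lee_fin !ger0_norm ?sqr_ge0//.
  have := sqr_ge0 (c * f x - g x); nra.
by have := sqr_ge0 (c * f x); have := sqr_ge0 (g x); nra.
Qed.

Lemma sq_integrableB f g : sq_integrable f -> sq_integrable g ->
  sq_integrable (fun x => f x - g x).
Proof.
move=> sf sg; have := sq_integrable_lin (-1) sg sf.
by congr sq_integrable; apply/funext => x; ring.
Qed.

Lemma Rintegral_mul_linl c f1 f2 g :
  sq_integrable f1 -> sq_integrable f2 -> sq_integrable g ->
  \int[mu]_(x in D) ((c * f1 x + f2 x) * g x) =
  c * \int[mu]_(x in D) (f1 x * g x) + \int[mu]_(x in D) (f2 x * g x).
Proof.
move=> s1 s2 sg; have i1 := sq_integrable_mul s1 sg; have i2 := sq_integrable_mul s2 sg.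
rewrite -RintegralZl// -RintegralD//.
  by apply: eq_Rintegral => x _; ring.
by apply: eq_integrable (integrableZl mD c i1) => // x _; rewrite /= EFinM.
Qed.

Lemma Rintegral_sum I (r : seq I) (F : I -> T -> R) :
  (forall i, mu.-integrable D (EFin \o F i)) ->
  \int[mu]_(x in D) (\sum_(i <- r) F i x) = \sum_(i <- r) \int[mu]_(x in D) F i x.
Proof.
move=> Fi; elim: r => [|i r IH].
  by under eq_Rintegral do rewrite big_nil; rewrite big_nil Rintegral_cst// mul0r.
under eq_Rintegral do rewrite big_cons.
rewrite big_cons -IH RintegralD//.
have := @integrable_sum _ _ _ mu D mD I r xpredT (fun i x => (F i x)%:E) (fun i _ => Fi i).
by apply: eq_integrable => // x _; rewrite /= sumEFin.
Qed.

Lemma sqr_integral0_ae f : sq_integrable f ->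
  \int[mu]_(x in D) (f x ^+ 2) = 0 -> {ae mu, forall x, D x -> f x = 0}.
Proof.
move=> sf f0; have : (\int[mu]_(x in D) `|((f x) ^+ 2)%:E| = 0)%E.
  under eq_integral do rewrite gee0_abs ?lee_fin ?sqr_ge0//.
  by rewrite -integral_sqrE// f0.
move=> /(ae_eq_integral_abs mu mD (measurable_sqr sf.1)).
apply: filterS => x h Dx; have /= [] := h Dx.
by move=> /eqP; rewrite sqrf_eq0 => /eqP.
Qed.

Lemma ae_imp (P Q : T -> Prop) : (forall x, P x -> Q x) ->
  {ae mu, forall x, P x} -> {ae mu, forall x, Q x}.
Proof. by move=> PQ; apply: filterS. Qed.

Lemma ae_Rintegral f g : measurable_fun D f -> measurable_fun D g ->
  {ae mu, forall x, D x -> f x = g x} ->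
  \int[mu]_(x in D) f x = \int[mu]_(x in D) g x.
Proof.
move=> mf mg fg; congr fine; apply: ae_eq_integral => //; first exact/measurable_EFinP.
  exact/measurable_EFinP.
by apply: filterS fg => x h Dx; rewrite h.
Qed.

Lemma ae_Rintegral_mul f g h :
  measurable_fun D f -> measurable_fun D g -> measurable_fun D h ->
  {ae mu, forall x, D x -> f x = g x} ->
  \int[mu]_(x in D) (f x * h x) = \int[mu]_(x in D) (g x * h x).
Proof.
move=> mf mg mh fg; apply: ae_Rintegral; try exact: measurable_funM.
by apply: filterS fg => x fg Dx; rewrite fg.
Qed.

(** Stated in the extended reals because the errors of the smooth approximations that define a trace
    may be infinite for some indices. *)
Lemma integral_le_comb (k : R) (A B C : T -> R) : 0 <= k ->
  measurable_fun D A -> measurable_fun D B -> measurable_fun D C ->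
  (forall x, 0 <= A x) -> (forall x, 0 <= B x) -> (forall x, 0 <= C x) ->
  (forall x, D x -> C x <= k * A x + 2 * B x) ->
  (\int[mu]_(x in D) (C x)%:E <=
   k%:E * \int[mu]_(x in D) (A x)%:E + 2%:E * \int[mu]_(x in D) (B x)%:E)%E.
Proof.
move=> k0 /measurable_EFinP mA /measurable_EFinP mB /measurable_EFinP mC A0 B0 C0 h.
have pos (c : R) (F : T -> R) : 0 <= c -> (forall x, 0 <= F x) ->
    forall x, D x -> (0 <= c%:E * (EFin \o F) x)%E.
  by move=> c0 F0 x _; apply: mule_ge0; rewrite lee_fin.
rewrite -(ge0_integralZl mu mD mA) ?lee_fin//; last by move=> x _; rewrite lee_fin.
rewrite -(ge0_integralZl mu mD mB) ?lee_fin//; last by move=> x _; rewrite lee_fin.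
rewrite -(ge0_integralD mu mD (pos k A k0 A0) (measurable_funeM k%:E mA)
  (pos 2 B (ler0n R 2) B0) (measurable_funeM 2%:E mB)).
apply: ge0_le_integral => //.
- by move=> x _; rewrite lee_fin.
- by apply: emeasurable_funD; exact: measurable_funeM.
Qed.

(** From |y| <= 1 + y^2 with y = 2^j t, an increment t satisfies |t| <= 2^-j + 2^j t^2, so the
    telescoping series of [u] converges absolutely. *)
Lemma summable_increments_cvg (u : nat -> R) :
  (\sum_(j <oo) (2 ^+ j * (u j.+1 - u j) ^+ 2)%:E < +oo)%E -> cvgn u.
Proof.
move=> S_fin; set w := fun j => 2 ^+ j * (u j.+1 - u j) ^+ 2.
have w_ge0 j : 0 <= w j by rewrite mulr_ge0 ?sqr_ge0 ?exprn_ge0.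
have S_ge0 : (0 <= \sum_(j <oo) (w j)%:E)%E by apply: nneseries_ge0 => j _ _; rewrite lee_fin.
have w_cvg : cvgn (series w).
  apply: nondecreasing_is_cvgn; first by apply: nondecreasing_series => j _ _.
  exists (fine (\sum_(j <oo) (w j)%:E)%E) => _ [m _ <-].
  rewrite -lee_fin fineK ?ge0_fin_numE// seriesEnat /= -sumEFin.
  by apply: nneseries_lim_ge => j _ _; rewrite lee_fin.
have g_cvg : cvgn (series (geometric 1 (2^-1) : nat -> R)).
  by apply: is_cvg_geometric_series; rewrite ger0_norm ?invr_ge0// invf_lt1// ltr1n.
have : cvgn (series (telescope u)).
  apply: normed_cvg; apply: series_le_cvg (is_cvg_seriesD g_cvg w_cvg).
  - by move=> j /=.
  - move=> j; apply: addr_ge0 => //.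
    by apply: mulr_ge0 => //; exact: exprn_ge0.
  - move=> j; change (`|u j.+1 - u j| <= 1 * 2^-1 ^+ j + w j).
    rewrite mul1r exprVn /w; set t := u j.+1 - u j.
    have p : 0 < 2 ^+ j :> R by rewrite exprn_gt0.
    rewrite -(ler_pM2l p) mulrDr mulfV ?gt_eqF// mulrA -expr2 -exprMn.
    rewrite -[X in X * _](gtr0_norm p) -normrM.
    set y := _ * t; rewrite -[y ^+ 2]real_normK ?num_real//.
    have := sqr_ge0 (`|y| - 1); have := normr_ge0 y; nra.
move=> /cvg_ex[l hl]; apply/cvg_ex; pose u0 := u 0%N; exists (u0 + l).
have c0 : (fun=> u0) @ \oo --> u0 by exact: cvg_cst.
suff -> : u = (fun=> u0) \+ series (telescope u) by exact: cvgD c0 hl.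
by apply/funext => n; rewrite [LHS]eq_sum_telescope.
Qed.

Lemma limn_einf_le (u : nat -> \bar R) (e : \bar R) (J : nat) :
  (forall j, (J <= j)%N -> (u j <= e)%E) -> (limn_einf u <= e)%E.
Proof.
move=> h; rewrite limn_einf_lim; apply: lime_le; first exact: is_cvg_einfs.
apply: nearW => n; apply: (@le_trans _ _ (u (maxn n J))); last by rewrite h// leq_maxr.
by apply: ereal_inf_lbound; exists (maxn n J) => //=; exact: leq_maxl.
Qed.

(* The weights [2 ^+ j] make [\sum_j 2 ^+ j * (g_(j+1) - g_j) ^+ 2] integrable
   along a fast subsequence [g], which forces [g] to converge a.e.; Fatou's
   lemma then transfers the Cauchy estimates to the limit. *)
Theorem Riesz_Fischer (f : nat -> T -> R) : (forall m, sq_integrable (f m)) ->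
  (forall e, 0 < e -> exists m0, forall m l, (m0 <= m)%N -> (m0 <= l)%N ->
     \int[mu]_(x in D) ((f m x - f l x) ^+ 2) <= e) ->
  exists g, sq_integrable g /\
    (fun m => \int[mu]_(x in D) ((f m x - g x) ^+ 2)) @ \oo --> 0.
Proof.
move=> sf cauchy.
(* Against the weight 2^j this leaves the summable 2^-j. *)
pose e (j : nat) : R := (4 ^+ j)^-1.
have e_gt0 j : 0 < e j by rewrite invr_gt0 exprn_gt0.
have /choice[s0 hs0] := fun j => cauchy (e j) (e_gt0 j).
(* The running maximum puts [s j] and [s j.+1] both past the Cauchy threshold [s0 j], and also gives
   j <= s j. *)
pose s j := \max_(i < j.+1) maxn i (s0 i).
have s_ge j i : (i <= j)%N -> (maxn i (s0 i) <= s j)%N.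
  rewrite -ltnS => ij.
  exact: (leq_bigmax_cond (F := fun i : 'I_j.+1 => maxn i (s0 i)) (Ordinal ij)).
have s_ge0 j i : (i <= j)%N -> (s0 i <= s j)%N.
  by move=> /s_ge; apply: leq_trans; exact: leq_maxr.
have s_geid j : (j <= s j)%N by apply: leq_trans (s_ge j j (leqnn j)); exact: leq_maxl.
have mf m : measurable_fun D (f m) by have [] := sf m.
pose g j := f (s j).
have mg j : measurable_fun D (g j) by exact: mf.
pose S x := (\sum_(j <oo) (2 ^+ j * (g j.+1 x - g j x) ^+ 2)%:E)%E.
have term_ge0 j x : (0 <= (2 ^+ j * (g j.+1 x - g j x) ^+ 2)%:E)%E.
  by rewrite lee_fin mulr_ge0 ?sqr_ge0 ?exprn_ge0.
have mterm j : measurable_fun D (fun x => (2 ^+ j * (g j.+1 x - g j x) ^+ 2)%:E).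
  apply/measurable_EFinP; apply: measurable_funM; first exact: measurable_cst.
  by apply: measurable_funX; exact: measurable_funB.
have S_int : (\int[mu]_(x in D) S x < +oo)%E.
  rewrite integral_nneseries//.
  apply: (@le_lt_trans _ _ (\sum_(j <oo) ((2^-1 : R) ^+ j)%:E)%E); last first.
    have h : (series (geometric 1 (2^-1 : R)) @ \oo --> (1 * (1 - 2^-1)^-1 : R)).
      by apply: cvg_geometric_series; rewrite ger0_norm ?invr_ge0// invf_lt1// ltr1n.
    apply: (@le_lt_trans _ _ (1 * (1 - 2^-1)^-1 : R)%:E); last exact: ltry.
    apply: lime_le; first by apply: is_cvg_nneseries => j _ _; rewrite lee_fin exprn_ge0.
    apply: nearW => m; rewrite sumEFin lee_fin.
    have -> : \sum_(0 <= i < m) (2^-1 : R) ^+ i = series (geometric 1 (2^-1 : R)) m.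
      by rewrite seriesEnat /=; apply: eq_bigr => i _; rewrite /geometric /= mul1r.
    rewrite -(cvg_lim _ h)//; apply: nondecreasing_cvgn_le => //.
      by apply: nondecreasing_series => i _ _; rewrite /geometric /= mul1r exprn_ge0.
    by apply: cvgP h.
  apply: lee_nneseries => [j _ _|j _]; first by apply: integral_ge0 => x _.
  under eq_integral do rewrite EFinM.
  have mi : measurable_fun D (fun x => ((g j.+1 x - g j x) ^+ 2)%:E).
    by apply: measurable_sqr; exact: measurable_funB.
  rewrite (ge0_integralZl mu mD mi) ?lee_fin ?exprn_ge0//; last first.
    by move=> x _; rewrite lee_fin sqr_ge0.
  rewrite -integral_sqrE; last exact: (sq_integrableB (sf _) (sf _)).
  rewrite -EFinM lee_fin; apply: (@le_trans _ _ (2 ^+ j * e j)).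
    by rewrite ler_wpM2l ?exprn_ge0// hs0 ?s_ge0// ltnW.
  rewrite /e exprVn (_ : 4 = 2 * 2); last by ring.
  by rewrite exprMn invfM mulrA mulfV ?mul1r// expf_neq0.
have S_ae : {ae mu, forall x, D x -> S x \is a fin_num}.
  apply: integrable_ae => //; apply/integrableP; split.
    have := @ge0_emeasurable_sum _ T R D
      (fun j x => (2 ^+ j * (g j.+1 x - g j x) ^+ 2)%:E) xpredT.
    by apply => [k x _ _|k _]; [exact: term_ge0|exact: mterm].
  rewrite (eq_integral S)// => x _; rewrite gee0_abs//.
  by apply: nneseries_ge0 => j _ _.
(* The upper limit is measurable whether or not the sequence converges; [fine] sends its infinite
   values to 0, which matters only on a null set. *)
pose G x := limn_esup (fun j => (g j x)%:E).
have mG : measurable_fun D G.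
  by apply: measurable_fun_limn_esup => j; apply/measurable_EFinP.
have mfG : measurable_fun D (fun x => fine (G x)).
  by apply: measurableT_comp mG; exact: fine_measurable.
(* The index m stays fixed while j tends to infinity, so a Cauchy bound becomes a bound on the
   distance from [f m] to the limit. *)
have fatou_bound m (eps : R) (J : nat) :
    (forall j, (J <= j)%N -> \int[mu]_(x in D) ((f m x - g j x) ^+ 2) <= eps) ->
    (\int[mu]_(x in D) ((f m x - fine (G x)) ^+ 2)%:E <= eps%:E)%E.
  move=> h.
  have mmg j : measurable_fun D (fun x => ((f m x - g j x) ^+ 2)%:E).
    by apply: measurable_sqr; exact: measurable_funB.
  have -> : (\int[mu]_(x in D) ((f m x - fine (G x)) ^+ 2)%:E =
      \int[mu]_(x in D) limn_einf (fun j => ((f m x - g j x) ^+ 2)%:E))%E.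
    apply: ge0_ae_eq_integral => //.
    - by apply: measurable_sqr; exact: measurable_funB.
    - under eq_fun do rewrite -[limn_einf _]oppeK -limn_esupN.
      apply: measurableT_comp => //.
      by apply: measurable_fun_limn_esup => j; exact: measurableT_comp.
    - by move=> x _; rewrite lee_fin sqr_ge0.
    - move=> x _; rewrite limn_einf_lim; apply: lime_ge; first exact: is_cvg_einfs.
      apply: nearW => n; apply: le_ereal_inf_tmp => _ [k _ <-].
      by rewrite lee_fin sqr_ge0.
    apply: filterS S_ae => x Sx Dx; have {}Sx := Sx Dx.
    have /cvg_ex[l gl] : cvgn (fun j => g j x).
      by apply: summable_increments_cvg; rewrite ltey_eq Sx.
    have cE (u : nat -> R) (c : R) : u @ \oo --> c -> (fun j => (u j)%:E) @ \oo --> c%:E.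
      by move=> h'; apply: cvg_EFin => //; exact: nearW.
    have GE : G x = l%:E by have [_] := cvg_limn_einf_sup (cE _ _ gl).
    rewrite GE /=; apply/esym.
    have h2 : (fun j => (f m x - g j x) ^+ 2) @ \oo --> (f m x - l) ^+ 2.
      have h1 : (fun j => f m x - g j x) @ \oo --> f m x - l.
        by apply: cvgB gl; exact: cvg_cst.
      by rewrite expr2; under eq_fun do rewrite expr2; apply: cvgM; exact: h1.
    by have [] := cvg_limn_einf_sup (cE _ _ h2).
  apply: le_trans (fatou mu mD mmg _) _.
    by move=> j x _; rewrite lee_fin sqr_ge0.
  apply: (@limn_einf_le _ _ J) => j Jj.
  by rewrite -integral_sqrE ?lee_fin ?h//; exact: (sq_integrableB (sf _) (sf _)).
have bound eps : 0 < eps -> (exists m0, forall m, (m0 <= m)%N ->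
    (\int[mu]_(x in D) ((f m x - fine (G x)) ^+ 2)%:E <= eps%:E)%E).
  move=> eps_gt0; have [m0 hm0] := cauchy _ eps_gt0; exists m0 => k m0k.
  apply: (@fatou_bound k eps m0) => j m0j; apply: hm0 => //.
  exact: leq_trans m0j (s_geid j).
have sG : sq_integrable (fun x => fine (G x)).
  have [m0 hm0] := bound 1 ltr01.
  have sd : sq_integrable (fun x => f m0 x - fine (G x)).
    apply: sq_integrableP; first exact: measurable_funB.
    by apply: le_lt_trans (hm0 _ (leqnn _)) _; exact: ltry.
  have := sq_integrableB (sf m0) sd.
  by congr sq_integrable; apply/funext => x; ring.
exists (fun x => fine (G x)); split=> //.
apply/cvgrPdist_le => /= eps eps_gt0; have [m0 hm0] := bound _ eps_gt0.
exists m0 => //= m m0m; rewrite sub0r normrN ger0_norm.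
  by rewrite -lee_fin integral_sqrE ?hm0//; exact: (sq_integrableB (sf _) sG).
by apply: Rintegral_ge0 => x _; exact: sqr_ge0.
Qed.

End square_integrable.

(** * Smooth functions on a bounded open set *)

Section smooth_functions.
Context {R : realType} {n : nat}.
Local Notation Rd := 'rV[R]_n.+1.
Implicit Types f g : Rd -> R.

Lemma Ck_continuous k f : Ck k f -> continuous f.
Proof. by case: k => [|k] []. Qed.

Lemma CkS k f i : Ck k.+1 f ->
  (forall x, derivable f x (basis_vec i)) /\ Ck k ('D_(basis_vec i) f).
Proof. by move=> [_ /(_ i)]. Qed.

Lemma derive_lin c f g i : (forall x, derivable f x (@basis_vec R n i)) ->
  (forall x, derivable g x (basis_vec i)) ->
  'D_(basis_vec i) (fun x => c * f x + g x) =
  (fun x => c * 'D_(basis_vec i) f x + 'D_(basis_vec i) g x).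
Proof.
move=> df dg; apply/funext => x.
have -> : (fun x => c * f x + g x) = (c *: f) + g by [].
by rewrite deriveD ?deriveZ//; exact: derivableZ.
Qed.

Lemma continuous_lin c f g : continuous f -> continuous g ->
  continuous (fun x => c * f x + g x).
Proof.
move=> cf cg x.
have cc : (cst c : Rd -> R) @ x --> c by exact: cst_continuous.
exact: cvgD (cvgM cc (cf x)) (cg x).
Qed.

Lemma Ck_lin k c f g : Ck k f -> Ck k g -> Ck k (fun x => c * f x + g x).
Proof.
elim: k f g => [|k IH] f g fk gk; (split; last by []) || split.
- by apply: continuous_lin; [exact: Ck_continuous fk|exact: Ck_continuous gk].
- by apply: continuous_lin; [exact: Ck_continuous fk|exact: Ck_continuous gk].
move=> i; have [df cf] := CkS i fk; have [dg cg] := CkS i gk; split.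
  move=> x; have -> : (fun x => c * f x + g x) = (c *: f) + g by [].
  by apply: derivableD => //; exact: derivableZ.
by rewrite derive_lin//; exact: IH.
Qed.

Lemma smooth_continuous f : smooth f -> continuous f.
Proof. by move=> /(_ 0%N)/Ck_continuous. Qed.

Lemma smooth_derivable f i x : smooth f -> derivable f x (basis_vec i).
Proof. by move=> /(_ 1%N)/(CkS i)[+ _]; exact. Qed.

Lemma smooth_derive_continuous f i : smooth f -> continuous ('D_(basis_vec i) f).
Proof. by move=> /(_ 1%N)/(CkS i)[_]; exact: Ck_continuous. Qed.

Lemma smooth_lin c f g : smooth f -> smooth g -> smooth (fun x => c * f x + g x).
Proof. by move=> sf sg k; exact: Ck_lin. Qed.

Lemma classical_grad_lin c f g : smooth f -> smooth g ->
  classical_grad (fun x => c * f x + g x) =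
  (fun x => c *: classical_grad f x + classical_grad g x).
Proof.
move=> sf sg; apply/funext => x; apply/rowP => i; rewrite !mxE.
have h := @derive_lin c f g i (fun y => @smooth_derivable f i y sf) (fun y => @smooth_derivable g i y sg).
by have := congr1 (fun F : Rd -> R => F x) h.
Qed.

End smooth_functions.

Section bounded_open.
Context {R : realType} {n : nat} (Om : set 'rV[R]_n.+1).
Context (Om_open : open Om) (Om_bounded : bounded_set Om).
Local Notation Rd := 'rV[R]_n.+1.
Local Notation Leb := (caratheodory_type (leb_outer R n)).
Local Notation mu := (leb R n).
Implicit Types f g : Rd -> R.

Lemma measurable_Om : measurable (Om : set Leb).
Proof. by apply: open_caratheodory => //; exact: leb_half_space. Qed.

Lemma continuous_lmeasurable f : continuous f -> lmeasurable_fun Om f.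
Proof. by move=> cf; apply: continuous_caratheodory => //; exact: leb_half_space. Qed.

Lemma Om_sub_cube : exists B : R, forall x, Om x -> forall i, - B <= x 0 i <= B.
Proof.
have [B [_ hB]] := Om_bounded; exists (B + 1) => x Ox i.
have xB : `|x| <= B + 1 by apply: hB => //; rewrite ltrDl.
rewrite -ler_norml; apply: le_trans xB.
rewrite [leRHS]mx_normrE.
exact: (le_bigmax _ (fun ij => `|x ij.1 ij.2|) (ord0, i)).
Qed.

(** One large closed cube followed by empty sets is an admissible cover. *)
Lemma leb_Om_fin : (mu (Om : set Leb) < +oo)%E.
Proof.
have [B hB] := Om_sub_cube.
pose C : set Rd := box (const_mx (- B), const_mx B).
pose F k : set Rd := if k is 0%N then C else set0.
apply: (@le_lt_trans _ _ (vol C)); last first.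
  by apply: le_lt_trans (vol_box_le _ _) _; exact: ltry.
have -> : vol C = (\sum_(k <oo) vol (F k))%E.
  rewrite nneseries_recl//; last by move=> k _; exact: vol_ge0.
  rewrite eseries0 ?adde0// => -[|k]//= _ _; exact: vol0.
apply: cover_outer_le => x Ox; exists 0%N => // i.
by rewrite /= !mxE; exact: hB.
Qed.

Lemma continuous_bounded_Om f : continuous f ->
  exists B, forall x, Om x -> `|f x| <= B.
Proof.
move=> cf; have [B hB] := Om_sub_cube.
have Kc : compact [set x : Rd | forall i, `[- B, B]%classic (x ord0 i)].
  apply: (@rV_compact R n.+1 (fun=> `[- B, B]%classic)) => i.
  exact: segment_compact.
have fK : compact (f @` [set x : Rd | forall i, `[- B, B]%classic (x ord0 i)]).
  by apply: continuous_compact Kc; exact: continuous_subspaceT.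
have [C [_ hC]] := compact_bounded fK; exists (C + 1) => x Ox.
apply: (hC (C + 1)); first by rewrite ltrDl.
by exists x => // i /=; rewrite in_itv /=; exact: hB.
Qed.

Lemma bounded_L2 f B : lmeasurable_fun Om f -> (forall x, Om x -> `|f x| <= B) -> L2 Om f.
Proof.
move=> mf hB; split=> //.
apply: (@measurable_bounded_integrable _ _ _ mu (fun x => f x ^+ 2)).
- exact: measurable_Om.
- exact: leb_Om_fin.
- exact: measurable_funX.
exists (B ^+ 2); split; first exact: num_real.
move=> C BC x Ox; apply: le_trans (ltW BC); rewrite normrX.
by rewrite lerXn2r ?nnegrE ?hB//; apply: le_trans (hB x Ox).
Qed.

Lemma continuous_L2 f : continuous f -> L2 Om f.
Proof.
move=> cf; have [B hB] := continuous_bounded_Om cf.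
by apply: bounded_L2 hB; exact: continuous_lmeasurable.
Qed.

Lemma L2_mul_bounded f g B : lmeasurable_fun Om g ->
  (forall x, Om x -> `|g x| <= B) -> L2 Om f -> L2 Om (fun x => g x * f x).
Proof.
move=> mg hB [mf fi].
have mgf : lmeasurable_fun Om (fun x => g x * f x) by exact: measurable_funM.
split=> //.
have i2 := integrableZl measurable_Om (B ^+ 2) fi.
apply: (le_integrable measurable_Om _ _ i2); first exact: measurable_sqr.
move=> x Ox; rewrite -!EFinM /= lee_fin ger0_norm ?sqr_ge0//.
apply: le_trans (ler_norm _); rewrite exprMn ler_wpM2r ?sqr_ge0//.
rewrite -[g x ^+ 2]real_normK ?num_real// lerXn2r ?nnegrE ?hB//.
exact: le_trans (hB x Ox).
Qed.

End bounded_open.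

(** * The space H1 *)

Lemma dotvE {R : realType} n (x y : 'rV[R]_n.+1) : dotv x y = \sum_i x 0 i * y 0 i.
Proof. by rewrite /dotv mxE; apply: eq_bigr => i _; rewrite mxE. Qed.

Lemma enorm_sqr {R : realType} n (x : 'rV[R]_n.+1) : enorm x ^+ 2 = \sum_i x 0 i ^+ 2.
Proof.
rewrite /enorm dotvE sqr_sqrtr; first by apply: eq_bigr => i _; rewrite expr2.
by apply: sumr_ge0 => i _; rewrite -expr2 sqr_ge0.
Qed.

Section L2_product.
Context {R : realType} {n : nat} (Om : set 'rV[R]_n.+1).
Context (Om_open : open Om) (Om_bounded : bounded_set Om).
Local Notation Rd := 'rV[R]_n.+1.
Local Notation E := (@fgrad R n).
Local Notation mu := (leb R n).
Implicit Types (f g : Rd -> R) (u v w : E).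

Definition ip f g : R := integral_on Om (fun x => f x * g x).

Let mOm := measurable_Om Om_open.

Lemma L2_lin c f g : L2 Om f -> L2 Om g -> L2 Om (fun x => c * f x + g x).
Proof. exact: (sq_integrable_lin mOm c). Qed.

Lemma L2_sum I (r : seq I) (F : I -> Rd -> R) :
  (forall i, L2 Om (F i)) -> L2 Om (fun x => \sum_(i <- r) F i x).
Proof.
move=> hF; elim: r => [|i r IH].
  under eq_fun do rewrite big_nil.
  by apply: continuous_L2 => //; exact: cst_continuous.
under eq_fun do rewrite big_cons -[F i _]mul1r.
exact: L2_lin.
Qed.

Lemma ip_lin c f1 f2 g : L2 Om f1 -> L2 Om f2 -> L2 Om g ->
  ip (fun x => c * f1 x + f2 x) g = c * ip f1 g + ip f2 g.
Proof. exact: (Rintegral_mul_linl mOm c). Qed.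

Lemma ipC f g : ip f g = ip g f.
Proof. by apply: eq_Rintegral => x _; rewrite mulrC. Qed.

Lemma ip_sqrE f : integral_on Om (fun x => f x ^+ 2) = ip f f.
Proof. by apply: eq_Rintegral => x _; rewrite expr2. Qed.

Lemma ip_ge0 f : 0 <= ip f f.
Proof. by apply: Rintegral_ge0 => x _; rewrite -expr2 sqr_ge0. Qed.

Lemma ip_CauchySchwarz f g : L2 Om f -> L2 Om g -> ip f g ^+ 2 <= ip f f * ip g g.
Proof.
move=> Lf Lg; apply: nonneg_quadratic_discr; first exact: ip_ge0.
move=> s; have := ip_ge0 (fun x => s * g x + f x).
have Lgf := L2_lin s Lg Lf.
rewrite ip_lin// [ip g _]ipC [ip f _]ipC !ip_lin// [ip g f]ipC.
by congr (_ <= _); ring.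
Qed.

Lemma ipB f1 f2 g : L2 Om f1 -> L2 Om f2 -> L2 Om g ->
  ip (fun x => f1 x - f2 x) g = ip f1 g - ip f2 g.
Proof.
move=> L1 L2' Lg; have <- : ip (fun x => -1 * f2 x + f1 x) g = ip f1 g - ip f2 g.
  by rewrite ip_lin//; ring.
by apply: eq_Rintegral => x _; ring.
Qed.

Lemma ip_cvg (f : nat -> Rd -> R) g h : (forall m, L2 Om (f m)) -> L2 Om g -> L2 Om h ->
  (fun m => ip (fun x => f m x - g x) (fun x => f m x - g x)) @ \oo --> 0 ->
  (fun m => ip (f m) h) @ \oo --> ip g h.
Proof.
move=> Lf Lg Lh cvg0.
have h0 : (fun m => ip (fun x => f m x - g x) h) @ \oo --> 0.
  apply: (cvg0_sqr_le _ cvg0) => m; apply: ip_CauchySchwarz => //.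
  exact: (sq_integrableB mOm (Lf m) Lg).
have -> : (fun m => ip (f m) h) =
    (fun m => ip (fun x => f m x - g x) h) \+ (fun=> ip g h).
  by apply/funext => m /=; rewrite ipB// subrK.
by rewrite -[X in _ --> X]add0r; apply: cvgD h0 _; exact: cvg_cst.
Qed.

Lemma ip0_ae f : L2 Om f -> ip f f = 0 -> ae_on Om (fun x => f x = 0).
Proof. exact: (sqr_integral0_ae mOm). Qed.

Lemma ae_ip f g h : L2 Om f -> L2 Om g -> L2 Om h ->
  ae_on Om (fun x => f x = g x) -> ip f h = ip g h.
Proof.
move=> [mf _] [mg _] [mh _]; exact: (ae_Rintegral_mul mOm mf mg mh).
Qed.

End L2_product.

Section H1_space.
Context {R : realType} {n : nat} (Om : set 'rV[R]_n.+1).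
Context (Om_open : open Om) (Om_bounded : bounded_set Om).
Local Notation Rd := 'rV[R]_n.+1.
Local Notation E := (@fgrad R n).
Local Notation mu := (leb R n).
Local Notation ip := (ip Om).
Implicit Types (f g : Rd -> R) (u v w : E).

Let mOm := measurable_Om Om_open.

Definition part (i : 'I_n.+1) u : Rd -> R := fun x => u.2 x 0 i.

Lemma part_lin i c u v : part i (c *: u + v) = (fun x => c * part i u x + part i v x).
Proof. by apply/funext => x; rewrite /part !mxE. Qed.

Lemma partB i u v : part i (u - v) = (fun x => part i u x - part i v x).
Proof. by apply/funext => x; rewrite /part !mxE. Qed.

Lemma test_L2 (phi : Rd -> R) i : test_function Om phi ->
  L2 Om phi /\ L2 Om ('D_(basis_vec i) phi).
Proof.
move=> [sphi _ _]; split; apply: continuous_L2 => //.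
  exact: smooth_continuous.
exact: smooth_derive_continuous.
Qed.

Lemma H1_lin c u v : H1 Om u -> H1 Om v -> H1 Om (c *: u + v).
Proof.
move=> [Lu Lu2 wu] [Lv Lv2 wv]; split.
- exact: (L2_lin Om_open c Lu Lv).
- move=> i; rewrite -/(part i _) part_lin; exact: (L2_lin Om_open c (Lu2 i) (Lv2 i)).
move=> phi i tphi; have [Lphi Ldphi] := test_L2 i tphi.
rewrite -!/(ip _ _) -/(part i _) part_lin.
rewrite (ip_lin Om_open c Lu Lv Ldphi) (ip_lin Om_open c (Lu2 i) (Lv2 i) Lphi).
have := wu phi i tphi; have := wv phi i tphi; rewrite -!/(ip _ _) => -> ->.
by rewrite /part; ring.
Qed.

(** Riesz-Fischer is applied to the function and to each partial derivative. The weak gradient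
    identity passes to the limit because test functions and their derivatives lie in L2 of the
    bounded set [Om]. *)
Lemma H1_complete (u : nat -> E) : (forall m, H1 Om (u m)) ->
  (forall eps, 0 < eps -> exists m0, forall m l, (m0 <= m)%N -> (m0 <= l)%N ->
     ip (u m - u l).1 (u m - u l).1 <= eps /\
     forall i, ip (part i (u m - u l)) (part i (u m - u l)) <= eps) ->
  exists w, [/\ H1 Om w, (fun m => ip (u m - w).1 (u m - w).1) @ \oo --> 0 &
    forall i, (fun m => ip (part i (u m - w)) (part i (u m - w))) @ \oo --> 0].
Proof.
move=> Hu cauchy.
have Lu m : L2 Om (u m).1 by have [] := Hu m.
have Lu2 i m : L2 Om (part i (u m)) by have [_ + _] := Hu m; exact.
have [g [Lg gcvg]] : exists g, L2 Om g /\
    (fun m => ip (fun x => (u m).1 x - g x) (fun x => (u m).1 x - g x)) @ \oo --> 0.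
  have [|g [Lg gcvg]] := Riesz_Fischer mOm Lu.
    move=> eps /cauchy[m0 hm0]; exists m0 => m l m0m m0l.
    by have [+ _] := hm0 m l m0m m0l; rewrite -ip_sqrE.
  by exists g; split=> //; move: gcvg; under eq_fun do rewrite -/(integral_on _ _) (ip_sqrE _ (fun x => _ - _)).
have /choice[G hG] : forall i, exists g, L2 Om g /\
    (fun m => ip (fun x => part i (u m) x - g x) (fun x => part i (u m) x - g x)) @ \oo --> 0.
  move=> i; have [|g' [Lg' gcvg']] := Riesz_Fischer mOm (Lu2 i).
    move=> eps /cauchy[m0 hm0]; exists m0 => m l m0m m0l.
    by have [_ /(_ i)] := hm0 m l m0m m0l; rewrite -ip_sqrE partB.
  by exists g'; split=> //; move: gcvg'; under eq_fun do rewrite -/(integral_on _ _) (ip_sqrE _ (fun x => _ - _)).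
pose w : E := (g, fun x => \row_i G i x).
have partw i : part i w = G i by apply/funext => x; rewrite /part mxE.
exists w; split; last 2 first.
- exact: gcvg.
- move=> i; have [_] := hG i; under [in X in _ -> X]eq_fun do rewrite partB partw.
  by [].
split=> //.
  by move=> i; rewrite -/(part i w) partw; have [] := hG i.
move=> phi i tphi; have [Lphi Ldphi] := test_L2 i tphi.
rewrite -!/(ip _ _) -/(part i w) partw.
have [LG Gcvg] := hG i.
have c1 := ip_cvg Om_open Lu Lg Ldphi gcvg.
have c2 := ip_cvg Om_open (Lu2 i) LG Lphi Gcvg.
apply: (cvg_unique _ c1) => //.
have -> : (fun m => ip (u m).1 ('D_(basis_vec i) phi)) =
    (fun m => - ip (part i (u m)) phi).
  by apply/funext => m; have [_ _ /(_ phi i tphi)] := Hu m.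
exact: cvgN.
Qed.

End H1_space.

(** * The energy form *)

Section diffusion.
Context {R : realType} {n : nat} (Om : set 'rV[R]_n.+1).
Context (alpha : 'rV[R]_n.+1 -> 'M[R]_n.+1) (alpha0 alpha1 : R).
Context (alpha0_gt0 : 0 < alpha0) (halpha : diffusion_tensor Om alpha alpha0 alpha1).
Local Notation Rd := 'rV[R]_n.+1.

Lemma alpha_sym x : Om x -> (alpha x)^T = alpha x.
Proof. by move=> /(proj2 halpha)[]. Qed.

Lemma alpha_form x (y z : Rd) : Om x -> dotv (y *m (alpha x)^T) z = (y *m alpha x *m z^T) 0 0.
Proof. by move=> Ox; rewrite /dotv alpha_sym. Qed.

Lemma alpha_formC x (y z : Rd) : Om x ->
  dotv (y *m (alpha x)^T) z = dotv (z *m (alpha x)^T) y.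
Proof.
move=> Ox; rewrite !alpha_form//.
have -> : y *m alpha x *m z^T = (z *m alpha x *m y^T)^T.
  by rewrite !trmx_mul trmxK alpha_sym// mulmxA.
by rewrite mxE.
Qed.

Lemma alpha_bounds x (y : Rd) : Om x ->
  alpha0 * enorm y ^+ 2 <= dotv (y *m (alpha x)^T) y <= alpha1 * enorm y ^+ 2.
Proof.
move=> Ox; rewrite alpha_form//.
by have [_ /(_ y^T)] := proj2 halpha x Ox; rewrite !trmxK.
Qed.

Lemma alpha_entry x i j : Om x ->
  (delta_mx 0 i *m alpha x *m (delta_mx 0 j)^T : 'M[R]_1) 0 0 = alpha x i j.
Proof. by rewrite -rowE trmx_delta -colE !mxE. Qed.

(** Nonnegativity of the form at e_i + e_j and e_i - e_j bounds 2 |alpha_ij| by alpha_ii + alpha_jj,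
    and a diagonal entry is the form at a unit vector. *)
Lemma alpha_bounded x i j : Om x -> `|alpha x i j| <= alpha1.
Proof.
move=> Ox; pose q (y : Rd) := dotv (y *m (alpha x)^T) y.
have q_ge0 y : 0 <= q y.
  have /andP[h _] := alpha_bounds y Ox; apply: le_trans h.
  by rewrite mulr_ge0 ?sqr_ge0// ltW.
have diag k : alpha x k k <= alpha1.
  have /andP[_] := alpha_bounds (delta_mx 0 k) Ox; rewrite alpha_form// alpha_entry//.
  rewrite enorm_sqr (bigD1 k)//= big1 => [|m mk]; last first.
    by rewrite mxE eqxx (negbTE mk) expr0n.
  by rewrite mxE !eqxx expr1n addr0 mulr1.
have sym : alpha x j i = alpha x i j by rewrite -[in RHS](alpha_sym Ox) mxE.
have qE s : q (delta_mx 0 i + s *: delta_mx 0 j) =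
    alpha x i i + 2 * s * alpha x i j + s ^+ 2 * alpha x j j.
  rewrite /q alpha_form//.
  have -> : (delta_mx 0 i + s *: delta_mx 0 j : Rd)^T =
      (delta_mx 0 i : Rd)^T + s *: (delta_mx 0 j : Rd)^T.
    by apply/matrixP => a b; rewrite !mxE.
  rewrite !mulmxDl !mulmxDr -!(scalemxAl, scalemxAr).
  pose e (k l : 'I_n.+1) := ((delta_mx 0 k : Rd) *m alpha x *m (delta_mx 0 l : Rd)^T) 0 0.
  transitivity (e i i + s * e i j + (s * e j i + s * (s * e j j))).
    by rewrite /e !mxE.
  by rewrite /e !alpha_entry// sym; ring.
have := q_ge0 (delta_mx 0 i + 1 *: delta_mx 0 j).
have := q_ge0 (delta_mx 0 i + (-1) *: delta_mx 0 j).
rewrite !qE ler_norml; have := diag i; have := diag j; lra.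
Qed.

End diffusion.

Section energy_form.
Context {R : realType} {n : nat} (Om : set 'rV[R]_n.+1).
Context (Om_open : open Om) (Om_bounded : bounded_set Om).
Context (alpha : 'rV[R]_n.+1 -> 'M[R]_n.+1) (alpha0 alpha1 : R).
Context (alpha0_gt0 : 0 < alpha0) (halpha : diffusion_tensor Om alpha alpha0 alpha1).
Context (q : 'rV[R]_n.+1 -> R) (M : R) (mq : lmeasurable_fun Om q).
Context (q_bounds : forall x, Om x -> 0 <= q x <= M).
Local Notation Rd := 'rV[R]_n.+1.
Local Notation E := (@fgrad R n).
Local Notation mu := (leb R n).
Local Notation ip := (ip Om).
Local Notation a := (bilin Om alpha q).
Implicit Types (u v w : E).

Let mOm := measurable_Om Om_open.

Definition flux i u : Rd -> R := fun x => \sum_j alpha x i j * part j u x.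

Lemma flux_lin i c u v : flux i (c *: u + v) = (fun x => c * flux i u x + flux i v x).
Proof.
apply/funext => x; rewrite /flux mulr_sumr -big_split /=; apply: eq_bigr => j _.
by rewrite part_lin; ring.
Qed.

Lemma dotv_flux u v x :
  dotv (u.2 x *m (alpha x)^T) (v.2 x) = \sum_i flux i u x * part i v x.
Proof.
rewrite dotvE; apply: eq_bigr => i _; congr (_ * _); rewrite mxE.
by apply: eq_bigr => j _; rewrite mxE mulrC.
Qed.

Lemma part_L2 i u : H1 Om u -> L2 Om (part i u).
Proof. by case=> _ + _; exact. Qed.

Lemma flux_L2 i u : H1 Om u -> L2 Om (flux i u).
Proof.
move=> Hu; apply: (L2_sum Om_open Om_bounded) => j.
apply: (L2_mul_bounded Om_open (B := alpha1)); last exact: part_L2.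
  by have [+ _] := halpha; exact.
by move=> x Ox; exact: (alpha_bounded alpha0_gt0 halpha).
Qed.

Lemma potential_L2 u : H1 Om u -> L2 Om (fun x => q x * u.1 x).
Proof.
move=> [Lu _ _]; apply: (L2_mul_bounded Om_open (B := M)) => //.
by move=> x Ox; have /andP[q0 qM] := q_bounds Ox; rewrite ger0_norm.
Qed.

Lemma bilinE u v : H1 Om u -> H1 Om v ->
  a u v = \sum_i ip (flux i u) (part i v) + ip (fun x => q x * u.1 x) v.1.
Proof.
move=> Hu Hv; congr (_ + _).
rewrite /integral_on; under eq_Rintegral do rewrite dotv_flux.
apply: Rintegral_sum => // i.
exact: (sq_integrable_mul mOm (flux_L2 i Hu) (part_L2 i Hv)).
Qed.

Lemma diffusion_integrable u v : H1 Om u -> H1 Om v ->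
  mu.-integrable Om (EFin \o (fun x => dotv (u.2 x *m (alpha x)^T) (v.2 x))).
Proof.
move=> Hu Hv.
have := @integrable_sum _ _ _ mu Om mOm _ (index_enum 'I_n.+1) xpredT
  (fun i x => (flux i u x * part i v x)%:E)
  (fun i _ => sq_integrable_mul mOm (flux_L2 i Hu) (part_L2 i Hv)).
by apply: eq_integrable => // x _; rewrite /= sumEFin dotv_flux.
Qed.

Lemma bilin_lin c u v w : H1 Om u -> H1 Om v -> H1 Om w ->
  a (c *: u + v) w = c * a u w + a v w.
Proof.
move=> Hu Hv Hw; have Huv := H1_lin Om_open Om_bounded c Hu Hv.
rewrite !bilinE// mulrDr addrACA; congr (_ + _).
  rewrite mulr_sumr -big_split /=; apply: eq_bigr => i _.
  by rewrite flux_lin (ip_lin Om_open c (flux_L2 i Hu) (flux_L2 i Hv) (part_L2 i Hw)).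
have [Lw _ _] := Hw.
rewrite -(ip_lin Om_open c (potential_L2 Hu) (potential_L2 Hv) Lw).
by congr (ip _ _); apply/funext => x /=; rewrite mulrDr; congr (_ + _); rewrite mulrCA.
Qed.

Lemma bilinC u v : a u v = a v u.
Proof.
congr (_ + _); apply: eq_Rintegral => x /set_mem Ox.
  exact: (alpha_formC halpha).
by rewrite mulrAC.
Qed.

Lemma potential_ge0 u : 0 <= integral_on Om (fun x => q x * u.1 x * u.1 x).
Proof.
apply: Rintegral_ge0 => x Ox; have /andP[q0 _] := q_bounds Ox.
by rewrite -mulrA -expr2 mulr_ge0 ?sqr_ge0.
Qed.

Lemma bilin_coercive i u : H1 Om u -> alpha0 * ip (part i u) (part i u) <= a u u.
Proof.
move=> Hu; rewrite -[leLHS]addr0; apply: lerD; last exact: potential_ge0.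
have iu := sq_integrable_mul mOm (part_L2 i Hu) (part_L2 i Hu).
rewrite -(RintegralZl _ mOm iu); apply: le_Rintegral => //.
- by apply: eq_integrable (integrableZl mOm alpha0 iu).
- exact: diffusion_integrable.
move=> x Ox; have /andP[h _] := alpha_bounds halpha (u.2 x) Ox; apply: le_trans h.
rewrite ler_pM2l// enorm_sqr (bigD1 i)//= -expr2 lerDl.
by apply: sumr_ge0 => j _; exact: sqr_ge0.
Qed.

Lemma bilin_bounded u : H1 Om u ->
  a u u <= alpha1 * \sum_i ip (part i u) (part i u) + M * ip u.1 u.1.
Proof.
move=> Hu; have [Lu _ _] := Hu.
have iu i := sq_integrable_mul mOm (part_L2 i Hu) (part_L2 i Hu).
have iu1 := sq_integrable_mul mOm Lu Lu.
apply: lerD.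
  rewrite mulr_sumr (_ : \sum_i _ =
      \int[mu]_(x in Om) (\sum_i alpha1 * (part i u x * part i u x))).
    apply: le_Rintegral => //; first exact: diffusion_integrable.
      have := @integrable_sum _ _ _ mu Om mOm _ (index_enum 'I_n.+1) xpredT
        (fun i x => alpha1%:E * (part i u x * part i u x)%:E)%E
        (fun i _ => integrableZl mOm alpha1 (iu i)).
      by apply: eq_integrable => // x _; rewrite /= -sumEFin; apply: eq_bigr.
    move=> x Ox; have /andP[_ h] := alpha_bounds halpha (u.2 x) Ox; apply: le_trans h _.
    rewrite enorm_sqr mulr_sumr; apply: ler_sum => i _; by rewrite expr2.
  rewrite Rintegral_sum => [|//|i]; last exact: (integrableZl mOm alpha1 (iu i)).
  by apply: eq_bigr => i _; rewrite -(RintegralZl _ mOm (iu i)).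
rewrite -(RintegralZl _ mOm iu1); apply: le_Rintegral => //.
- by have := sq_integrable_mul mOm (potential_L2 Hu) Lu.
- exact: (integrableZl mOm M iu1).
move=> x Ox; have /andP[_ qM] := q_bounds Ox.
by rewrite -mulrA ler_wpM2r// -expr2 sqr_ge0.
Qed.

Lemma l2_semi_lin c u v w : H1 Om u -> H1 Om v -> H1 Om w ->
  l2 Om (c *: u + v) w = c * l2 Om u w + l2 Om v w.
Proof. by move=> [Lu _ _] [Lv _ _] [Lw _ _]; exact: (ip_lin Om_open c Lu Lv Lw). Qed.

End energy_form.

Section clamp.
Context {R : realType} {n : nat} (Om : set 'rV[R]_n.+1).
Context (Om_open : open Om) (Om_bounded : bounded_set Om).
Context (alpha : 'rV[R]_n.+1 -> 'M[R]_n.+1) (q : 'rV[R]_n.+1 -> R).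

(** The bounds on [q] hold only a.e.; truncation to the interval from 0 to max (M, 0) makes them
    pointwise, as the estimates of the form require, without changing the form on H1. *)
Lemma clamp_potential : potential Om q -> exists q' M,
  [/\ lmeasurable_fun Om q', forall x, Om x -> 0 <= q' x <= M &
    forall u v, H1 Om u -> H1 Om v -> bilin Om alpha q u v = bilin Om alpha q' u v].
Proof.
move=> [mq [M hM]]; have mOm := measurable_Om Om_open.
pose B := Num.max M 0.
pose q' := (fun x => Num.min (Num.max (q x) 0) B).
have mq' : lmeasurable_fun Om q'.
  apply: measurable_minr; last exact: measurable_cst.
  by apply: measurable_maxr => //; exact: measurable_cst.
exists q', B; split=> //.
  move=> x _; apply/andP; split; first by rewrite /q' le_min !le_max !lexx !orbT.
  by rewrite /q' ge_min lexx orbT.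
move=> u v [[mu1 _] _ _] [[mv1 _] _ _]; congr (_ + _).
apply: (ae_Rintegral_mul mOm (measurable_funM mq mu1) (measurable_funM mq' mu1) mv1).
move: hM; apply: ae_imp => x h Ox; have /andP[q0 qM] := h Ox.
by rewrite /= /q' /B (max_l q0) min_l// le_max qM.
Qed.

End clamp.

(** * Vanishing traces *)

Lemma ereal_cvg0P {R : realType} (u : nat -> \bar R) : (forall m, 0 <= u m)%E ->
  (u @ \oo --> 0%E) <-> (forall e, 0 < e -> \forall m \near \oo, (u m <= e%:E)%E).
Proof.
move=> u0; split=> [uc e e0|h].
  have := uc [set x | (x < e%:E)%E]; rewrite /fmap /= => h.
  have {}h : \forall m \near \oo, (u m < e%:E)%E.
    by apply: h; apply: open_ereal_lt'; rewrite lte_fin.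
  by apply: filterS h => m /=; exact: ltW.
have fin : \forall m \near \oo, u m \is a fin_num.
  apply: filterS (h 1 ltr01) => m um.
  by rewrite ge0_fin_numE// (le_lt_trans um)// ltry.
apply/fine_cvgP; split=> //; apply/cvgrPdist_le => /= e e0.
near=> m; rewrite sub0r normrN ger0_norm ?fine_ge0//.
rewrite -lee_fin fineK; first by near: m; exact: h.
by near: m.
Unshelve. all: by end_near. Qed.

Lemma ereal_cvg0_comb {R : realType} (k : R) (u v w : nat -> \bar R) : 0 <= k ->
  (forall m, 0 <= u m)%E -> (forall m, 0 <= v m)%E -> (forall m, 0 <= w m)%E ->
  (forall m, w m <= k%:E * u m + 2%:E * v m)%E ->
  u @ \oo --> 0%E -> v @ \oo --> 0%E -> w @ \oo --> 0%E.
Proof.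
move=> k0 u0 v0 w0 h /(ereal_cvg0P u0) hu /(ereal_cvg0P v0) hv.
apply/(ereal_cvg0P w0) => e e0.
have k1 : 0 < 2 * (k + 1) by rewrite mulr_gt0// ltr_wpDl.
have d0 : 0 < e / (2 * (k + 1)) by rewrite divr_gt0.
have e4 : 0 < e / 4 by rewrite divr_gt0.
near=> m; apply: le_trans (h m) _.
apply: (@le_trans _ _ (k%:E * (e / (2 * (k + 1)))%:E + 2%:E * (e / 4)%:E)%E).
  by apply: leeD; apply: lee_wpmul2l; rewrite ?lee_fin//; near: m; [exact: hu|exact: hv].
rewrite -!EFinM -EFinD lee_fin.
have -> : k * (e / (2 * (k + 1))) = e / 2 * (k / (k + 1)) by field; rewrite gt_eqF// ltr_wpDl.
have : k / (k + 1) <= 1 by rewrite ler_pdivrMr ?ltr_wpDl// mul1r lerDl.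
move=> h1; have e2 : 0 <= e / 2 by rewrite divr_ge0 ?ltW.
have := ler_wpM2l e2 h1; lra.
Unshelve. all: by end_near. Qed.

Lemma cvg0_sum {R : realType} I (r : seq I) (f : I -> nat -> R) :
  (forall i, f i @ \oo --> 0) -> (fun m => \sum_(i <- r) f i m) @ \oo --> 0.
Proof.
move=> f0; elim: r => [|i r IH]; first by under eq_fun do rewrite big_nil; exact: cvg_cst.
under eq_fun do rewrite big_cons.
by have h := cvgD (f0 i) IH; rewrite addr0 in h; exact: h.
Qed.

Lemma sqr_comb_le {R : realFieldType} (c x y : R) :
  (c * x + y) ^+ 2 <= 2 * c ^+ 2 * x ^+ 2 + 2 * y ^+ 2.
Proof. have := sqr_ge0 (c * x - y); nra. Qed.

Lemma enorm_comb_le {R : realType} n (c : R) (x y : 'rV[R]_n.+1) :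
  enorm (c *: x + y) ^+ 2 <= 2 * c ^+ 2 * enorm x ^+ 2 + 2 * enorm y ^+ 2.
Proof.
rewrite !enorm_sqr !mulr_sumr -big_split /=; apply: ler_sum => i _.
by rewrite !mxE; exact: sqr_comb_le.
Qed.

Lemma measurable_enorm_sqr d (T : measurableType d) {R : realType} n (D : set T)
    (F : T -> 'rV[R]_n.+1) :
  (forall i, measurable_fun D (fun x => F x 0 i)) ->
  measurable_fun D (fun x => enorm (F x) ^+ 2).
Proof.
move=> mF; under eq_fun do rewrite enorm_sqr.
by apply: measurable_sum => i; exact: measurable_funX.
Qed.

Lemma int_sqr_ge0 d (T : measurableType d) {R : realType}
    (nu : {measure set T -> \bar R}) (D : set T) (F : T -> R) :
  (0 <= \int[nu]_(x in D) ((F x) ^+ 2)%:E)%E.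
Proof. by apply: integral_ge0 => x _; rewrite lee_fin sqr_ge0. Qed.

Section trace_space.
Context {R : realType} {n : nat} (Om GD : set 'rV[R]_n.+1).
Context (Om_open : open Om) (Om_bounded : bounded_set Om).
Context (mGD : measurable (GD : set (caratheodory_type (hausdorff_outer R n n)))).
Local Notation Rd := 'rV[R]_n.+1.
Local Notation E := (@fgrad R n).
Local Notation mu := (leb R n).
Local Notation surf := (surf R n).
Local Notation ip := (ip Om).
Implicit Types (u v : E) (f g : Rd -> R).

Let mOm := measurable_Om Om_open.

Lemma smooth_lmeasurable f : smooth f -> lmeasurable_fun Om f.
Proof. by move=> sf; apply: continuous_lmeasurable; exact: smooth_continuous. Qed.

Lemma smooth_surf_measurable f : smooth f ->
  measurable_fun (GD : set (caratheodory_type (hausdorff_outer R n n))) f.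
Proof.
move=> sf; apply: continuous_caratheodory; first exact: hausdorff_half_space.
exact: smooth_continuous.
Qed.

Lemma defect_measurable f u : smooth f -> H1 Om u ->
  lmeasurable_fun Om (fun x => f x - u.1 x).
Proof. by move=> sf [[mu1 _] _ _]; exact: (measurable_funB (smooth_lmeasurable sf) mu1). Qed.

Lemma grad_defect_measurable f u : smooth f -> H1 Om u ->
  lmeasurable_fun Om (fun x => enorm (classical_grad f x - u.2 x) ^+ 2).
Proof.
move=> sf [_ Lu2 _]; apply: measurable_enorm_sqr => i.
have [mui _] := Lu2 i.
have mf : lmeasurable_fun Om ('D_(basis_vec i) f).
  by apply: continuous_lmeasurable; exact: smooth_derive_continuous.
have -> : (fun x => (classical_grad f x - u.2 x) 0 i) =
    (fun x => 'D_(basis_vec i) f x - u.2 x 0 i) by apply/funext => x; rewrite !mxE.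
exact: (measurable_funB mf mui).
Qed.

Lemma has_trace_lin c u v : H1 Om u -> H1 Om v ->
  has_trace Om GD u (fun=> 0) -> has_trace Om GD v (fun=> 0) ->
  has_trace Om GD (c *: u + v) (fun=> 0).
Proof.
move=> Hu Hv [f [sf [cf1 cf2] cf3]] [g [sg [cg1 cg2] cg3]].
have Huv := H1_lin Om_open Om_bounded c Hu Hv.
have sfg m : smooth (fun x => c * f m x + g m x) by exact: smooth_lin.
have k0 : 0 <= 2 * c ^+ 2 by rewrite mulr_ge0 ?sqr_ge0.
exists (fun m x => c * f m x + g m x); split; [exact: sfg|split|].
- apply: (ereal_cvg0_comb k0 (fun m => int_sqr_ge0 _ _ _) (fun m => int_sqr_ge0 _ _ _)
    (fun m => int_sqr_ge0 _ _ _) _ cf1 cg1) => m.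
  apply: (integral_le_comb mu mOm k0
    (measurable_funX 2 (defect_measurable (sf m) Hu))
    (measurable_funX 2 (defect_measurable (sg m) Hv))
    (measurable_funX 2 (defect_measurable (sfg m) Huv))).
  + by move=> x; exact: sqr_ge0.
  + by move=> x; exact: sqr_ge0.
  + by move=> x; exact: sqr_ge0.
  move=> x _; change ((c * f m x + g m x - (c * u.1 x + v.1 x)) ^+ 2 <=
    2 * c ^+ 2 * (f m x - u.1 x) ^+ 2 + 2 * (g m x - v.1 x) ^+ 2).
  have -> : c * f m x + g m x - (c * u.1 x + v.1 x) =
    c * (f m x - u.1 x) + (g m x - v.1 x) by ring.
  exact: sqr_comb_le.
- apply: (ereal_cvg0_comb k0 (fun m => int_sqr_ge0 _ _ _) (fun m => int_sqr_ge0 _ _ _)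
    (fun m => int_sqr_ge0 _ _ _) _ cf2 cg2) => m.
  apply: (integral_le_comb mu mOm k0 (grad_defect_measurable (sf m) Hu)
    (grad_defect_measurable (sg m) Hv) (grad_defect_measurable (sfg m) Huv)).
  + by move=> x; exact: sqr_ge0.
  + by move=> x; exact: sqr_ge0.
  + by move=> x; exact: sqr_ge0.
  move=> x _; rewrite classical_grad_lin//.
  change (enorm (c *: classical_grad (f m) x + classical_grad (g m) x -
      (c *: u.2 x + v.2 x)) ^+ 2 <=
    2 * c ^+ 2 * enorm (classical_grad (f m) x - u.2 x) ^+ 2 +
    2 * enorm (classical_grad (g m) x - v.2 x) ^+ 2).
  by rewrite opprD addrACA -scalerBr; exact: enorm_comb_le.
- apply: (ereal_cvg0_comb k0 (fun m => int_sqr_ge0 _ _ _) (fun m => int_sqr_ge0 _ _ _)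
    (fun m => int_sqr_ge0 _ _ _) _ cf3 cg3) => m.
  have ms h : smooth h -> measurable_fun
      (GD : set (caratheodory_type (hausdorff_outer R n n))) (fun x => (h x - 0) ^+ 2).
    move=> sh; under eq_fun do rewrite subr0.
    exact: (measurable_funX 2 (smooth_surf_measurable sh)).
  apply: (integral_le_comb surf mGD k0 (ms _ (sf m)) (ms _ (sg m)) (ms _ (sfg m))).
  + by move=> x; exact: sqr_ge0.
  + by move=> x; exact: sqr_ge0.
  + by move=> x; exact: sqr_ge0.
  by move=> x _; rewrite !subr0; exact: sqr_comb_le.
Qed.

Lemma ereal_inv_cvg0 (w : nat -> \bar R) : (forall m, 0 <= w m)%E ->
  (forall m, w m <= (m.+1%:R^-1)%:E)%E -> w @ \oo --> 0%E.
Proof.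
move=> w0 h; apply/(ereal_cvg0P w0) => e e0.
exists (Num.bound e^-1) => // m /= hm; apply: le_trans (h m) _; rewrite lee_fin.
rewrite -[leRHS]invrK lef_pV2 ?posrE ?invr_gt0//; apply: ltW.
apply: lt_le_trans (archi_boundP _) _; first by rewrite invr_ge0 ltW.
by rewrite ler_nat ltnW.
Qed.

(** A diagonal choice: [w m] is a smooth approximation of [u m] whose squared errors in L2, in the
    gradient and on [GD] are at most 1 / (m + 1). Then [w] converges to v in H1 while its
    restrictions to [GD] tend to 0. *)
Lemma has_trace_closed (u : nat -> E) v : (forall m, H1 Om (u m)) -> H1 Om v ->
  (forall m, has_trace Om GD (u m) (fun=> 0)) ->
  (fun m => ip (u m - v).1 (u m - v).1) @ \oo --> 0 ->
  (forall i, (fun m => ip (part i (u m - v)) (part i (u m - v))) @ \oo --> 0) ->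
  has_trace Om GD v (fun=> 0).
Proof.
move=> Hu Hv tru cvg1 cvg2.
have /choice[w hw] : forall m, exists w : Rd -> R, [/\ smooth w,
    (\int[mu]_(x in Om) ((w x - (u m).1 x) ^+ 2)%:E <= (m.+1%:R^-1)%:E)%E,
    (\int[mu]_(x in Om) (enorm (classical_grad w x - (u m).2 x) ^+ 2)%:E <= (m.+1%:R^-1)%:E)%E &
    (\int[surf]_(x in GD) ((w x - 0) ^+ 2)%:E <= (m.+1%:R^-1)%:E)%E].
  move=> m; have [f [sf [cf1 cf2] cf3]] := tru m.
  have m0 : 0 < m.+1%:R^-1 :> R by rewrite invr_gt0.
  have h1 := (ereal_cvg0P (fun m => int_sqr_ge0 _ _ _)).1 cf1 _ m0.
  have h2 := (ereal_cvg0P (fun m => int_sqr_ge0 _ _ _)).1 cf2 _ m0.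
  have h3 := (ereal_cvg0P (fun m => int_sqr_ge0 _ _ _)).1 cf3 _ m0.
  have [j [[hj1 hj2] hj3]] := filter_ex (filterI (filterI h1 h2) h3).
  by exists (f j).
have sw m : smooth (w m) by have [] := hw m.
have k0 : 0 <= 2 :> R by [].
have Huv m : H1 Om (u m - v).
  by have := H1_lin Om_open Om_bounded (-1) Hv (Hu m); rewrite scaleN1r addrC.
have Lpart i m : L2 Om (part i (u m - v)) by have [_ + _] := Huv m; exact.
have Ldiff m : L2 Om (u m - v).1 by have [] := Huv m.
exists w; split; [exact: sw|split|].
- apply: (ereal_cvg0_comb k0
    (u := fun m => (\int[mu]_(x in Om) ((w m x - (u m).1 x) ^+ 2)%:E)%E)
    (v := fun m => (ip (u m - v).1 (u m - v).1)%:E)) => [m|m|m|m||].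
  + exact: int_sqr_ge0.
  + by rewrite lee_fin ip_ge0.
  + exact: int_sqr_ge0.
  + have -> : (ip (u m - v).1 (u m - v).1)%:E =
        (\int[mu]_(x in Om) (((u m - v).1 x) ^+ 2)%:E)%E.
      by rewrite -ip_sqrE; exact: (integral_sqrE mOm (Ldiff m)).
    apply: (integral_le_comb mu mOm k0
      (measurable_funX 2 (defect_measurable (sw m) (Hu m)))
      (measurable_funX 2 (proj1 (Ldiff m)))
      (measurable_funX 2 (defect_measurable (sw m) Hv))).
    * by move=> x; exact: sqr_ge0.
    * by move=> x; exact: sqr_ge0.
    * by move=> x; exact: sqr_ge0.
    move=> x _; have := sqr_comb_le 1 (w m x - (u m).1 x) ((u m).1 x - v.1 x).
    by rewrite expr1n mulr1 mul1r subrKA.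
  + by apply: ereal_inv_cvg0 => m; [exact: int_sqr_ge0|have [] := hw m].
  + by apply: cvg_EFin => //; exact: nearW.
- apply: (ereal_cvg0_comb k0
    (u := fun m => (\int[mu]_(x in Om) (enorm (classical_grad (w m) x - (u m).2 x) ^+ 2)%:E)%E)
    (v := fun m => (\sum_i ip (part i (u m - v)) (part i (u m - v)))%:E)) => [m|m|m|m||].
  + exact: int_sqr_ge0.
  + by rewrite lee_fin; apply: sumr_ge0 => i _; exact: ip_ge0.
  + exact: int_sqr_ge0.
  + have int_i i := sq_integrable_mul mOm (Lpart i m) (Lpart i m).
    have -> : (\sum_i ip (part i (u m - v)) (part i (u m - v)))%:E =
        (\int[mu]_(x in Om) (enorm ((u m - v).2 x) ^+ 2)%:E)%E.
      have sumE x : enorm ((u m - v).2 x) ^+ 2 =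
          \sum_i part i (u m - v) x * part i (u m - v) x.
        by rewrite enorm_sqr; apply: eq_bigr => i _; rewrite expr2.
      under eq_integral do rewrite sumE.
      rewrite -(Rintegral_sum mOm (index_enum 'I_n.+1) int_i) fineK//; apply: integrable_fin_num => //.
      have := @integrable_sum _ _ _ mu Om mOm _ (index_enum 'I_n.+1) xpredT
        (fun i x => (part i (u m - v) x * part i (u m - v) x)%:E) (fun i _ => int_i i).
      by apply: eq_integrable => // x _; rewrite /= sumEFin.
    apply: (integral_le_comb mu mOm k0 (grad_defect_measurable (sw m) (Hu m))
      (measurable_enorm_sqr (fun i => proj1 (Lpart i m)))
      (grad_defect_measurable (sw m) Hv)).
    * by move=> x; exact: sqr_ge0.
    * by move=> x; exact: sqr_ge0.
    * by move=> x; exact: sqr_ge0.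
    move=> x _.
    have := enorm_comb_le 1 (classical_grad (w m) x - (u m).2 x) ((u m).2 x - v.2 x).
    by rewrite expr1n mulr1 scale1r subrKA.
  + by apply: ereal_inv_cvg0 => m; [exact: int_sqr_ge0|have [] := hw m].
  + apply: cvg_EFin; first exact: nearW.
    exact: cvg0_sum cvg2.
- by apply: ereal_inv_cvg0 => m; [exact: int_sqr_ge0|have [] := hw m].
Qed.

End trace_space.

(** * Subspaces as types *)

(** The abstract results quantify over all vectors, whereas [bilin] and [l2] are known to be linear
    only on H1, where the products are integrable. Making [V] an [lmodType] of its own turns both
    into semi-inner products on the whole space. *)
Record linear_subspace (R : realType) (E : lmodType R) := LinearSubspace {
  subspace_set : set E;
  subspace_closed : submod_closed (fun u => `[<subspace_set u>]) }.

Section subspace_type.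
Context {R : realType} {E : lmodType R} (S : linear_subspace E).

Definition subspace_pred : {pred E} := fun u => `[<subspace_set S u>].

HB.instance Definition _ :=
  GRing.isSubmodClosed.Build R E subspace_pred (subspace_closed S).

Record subspace_of := SubspaceOf {
  subspace_val : E; _ : subspace_val \in subspace_pred }.

HB.instance Definition _ := [isSub for subspace_val].
HB.instance Definition _ := [Choice of subspace_of by <:].
HB.instance Definition _ := [SubChoice_isSubLmodule of subspace_of by <:].

Definition to_subspace u (Su : subspace_set S u) : subspace_of := SubspaceOf (asboolT Su : u \in subspace_pred).

Lemma subspace_valP (u : subspace_of) : subspace_set S (subspace_val u).
Proof. by case: u => u /= /asboolP. Qed.

Lemma subspace_val_lin c (u v : subspace_of) :
  subspace_val (c *: u + v) = c *: subspace_val u + subspace_val v.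
Proof. by []. Qed.

Lemma subspace_valB (u v : subspace_of) :
  subspace_val (u - v) = subspace_val u - subspace_val v.
Proof. by []. Qed.

Lemma subspace_val_sum I (r : seq I) (c : I -> R) (F : I -> subspace_of) :
  subspace_val (\sum_(i <- r) c i *: F i) = \sum_(i <- r) c i *: subspace_val (F i).
Proof. by elim: r => [|i r IH]; rewrite ?big_nil// !big_cons subspace_val_lin IH. Qed.

End subspace_type.

(** * Admissible spaces *)

Section energy_space.
Context {R : realType} {n : nat} (Om : set 'rV[R]_n.+1).
Context (Om_open : open Om) (Om_bounded : bounded_set Om).
Local Notation E := (@fgrad R n).
Local Notation ip := (ip Om).
Implicit Types (u v w : E).

(** The common ground of the two kinds of boundary conditions; closedness refers to the H1 norm,
    with the limit already known to be in H1. *)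
Record admissible_space (V : set E) : Prop := AdmissibleSpace {
  admissible_H1 : forall u, V u -> H1 Om u;
  admissible_lin : forall c u v, V u -> V v -> V (c *: u + v);
  admissible_closed : forall (u : nat -> E) w, (forall m, V (u m)) -> H1 Om w ->
    (fun m => ip (u m - w).1 (u m - w).1) @ \oo --> 0 ->
    (forall i, (fun m => ip (part i (u m - w)) (part i (u m - w))) @ \oo --> 0) ->
    V w }.

Lemma admissible_boundary_conditions (V : set E) :
  V = H1 Om \/ (exists2 GD, dirichlet_part Om GD & V = H1_D Om GD) ->
  admissible_space V.
Proof.
move=> [->|[GD [_ mGD] ->]]; split.
- by [].
- by move=> c u v; exact: H1_lin.
- by [].
- by move=> u [].
- move=> c u v [Hu tu] [Hv tv]; split; first exact: (H1_lin Om_open Om_bounded).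
  exact: (has_trace_lin Om_open Om_bounded mGD c Hu Hv tu tv).
move=> u w Vu Hw c1 c2; split=> //.
exact: (has_trace_closed Om_open Om_bounded (fun m => (Vu m).1) Hw (fun m => (Vu m).2) c1 c2).
Qed.

Context (alpha : 'rV[R]_n.+1 -> 'M[R]_n.+1) (alpha0 alpha1 : R).
Context (alpha0_gt0 : 0 < alpha0) (halpha : diffusion_tensor Om alpha alpha0 alpha1).
Context (q : 'rV[R]_n.+1 -> R) (hq : potential Om q).
Local Notation a := (bilin Om alpha q).
Context (V : set E) (hV : admissible_space V).

Lemma admissible_bilin_lin c u v w : V u -> V v -> V w ->
  a (c *: u + v) w = c * a u w + a v w.
Proof.
move=> /(admissible_H1 hV) Hu /(admissible_H1 hV) Hv /(admissible_H1 hV) Hw.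
have [q' [M [mq' q'_bounds qq']]] := clamp_potential Om_open alpha hq.
by rewrite !qq'//; [exact: (bilin_lin Om_open Om_bounded alpha0_gt0 halpha mq' q'_bounds)|exact: H1_lin].
Qed.

Lemma admissible_bilin_coercive i u : V u -> alpha0 * ip (part i u) (part i u) <= a u u.
Proof.
move=> /(admissible_H1 hV) Hu.
have [q' [M [mq' q'_bounds ->//]]] := clamp_potential Om_open alpha hq.
exact: (bilin_coercive Om_open Om_bounded alpha0_gt0 halpha q'_bounds).
Qed.

Lemma admissible_bilin_ge0 u : V u -> 0 <= a u u.
Proof.
move=> Vu; apply: le_trans (admissible_bilin_coercive ord0 Vu).
by rewrite mulr_ge0 ?ip_ge0// ltW.
Qed.

Lemma admissible_bilin_bounded : exists M, forall u, V u ->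
  a u u <= alpha1 * \sum_i ip (part i u) (part i u) + M * ip u.1 u.1.
Proof.
have [q' [M [mq' q'_bounds qq']]] := clamp_potential Om_open alpha hq.
exists M => u /(admissible_H1 hV) Hu; rewrite qq'//.
exact: (bilin_bounded Om_open Om_bounded alpha0_gt0 halpha mq' q'_bounds).
Qed.

Lemma admissible_l2_lin c u v w : V u -> V v -> V w ->
  l2 Om (c *: u + v) w = c * l2 Om u w + l2 Om v w.
Proof. by move=> *; apply: l2_semi_lin => //; exact: (admissible_H1 hV). Qed.

Lemma admissibleB u v : V u -> V v -> V (u - v).
Proof. by move=> Vu Vv; rewrite addrC -scaleN1r; exact: admissible_lin. Qed.

(** Coercivity makes a Cauchy sequence for a + l2 Cauchy in H1, and its H1 limit stays in [V]. The
    upper bound on the form turns H1 convergence back into energy convergence. *)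
Lemma admissible_complete (u : nat -> E) : (forall m, V (u m)) ->
  (forall eps, 0 < eps -> exists m0, forall m l, (m0 <= m)%N -> (m0 <= l)%N ->
     a (u m - u l) (u m - u l) + l2 Om (u m - u l) (u m - u l) <= eps) ->
  exists w, [/\ V w, (fun m => a (u m - w) (u m - w)) @ \oo --> 0 &
    (fun m => l2 Om (u m - w) (u m - w)) @ \oo --> 0].
Proof.
move=> Vu cauchy.
have [|w [Hw cvg1 cvg2]] := @H1_complete R n Om Om_open Om_bounded u
    (fun m => admissible_H1 hV (Vu m)).
  move=> eps eps0; pose d := Num.min alpha0 1 * eps.
  have d0 : 0 < d by rewrite mulr_gt0// lt_min alpha0_gt0 ltr01.
  have [m0 hm0] := cauchy d d0; exists m0 => m l m0m m0l.
  have Vd := admissibleB (Vu m) (Vu l).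
  have := hm0 m l m0m m0l.
  have a_ge0 := admissible_bilin_ge0 Vd.
  have b_ge0 : 0 <= l2 Om (u m - u l) (u m - u l) := ip_ge0 _ _.
  move=> h; split.
    apply: (@le_trans _ _ d); first by apply: le_trans h; rewrite lerDr.
    by rewrite -[leRHS]mul1r ler_pM2r// ge_min lexx orbT.
  move=> i; rewrite -(ler_pM2l alpha0_gt0).
  apply: le_trans (admissible_bilin_coercive i Vd) _.
  apply: (@le_trans _ _ d); first by apply: le_trans h; rewrite lerDl.
  by rewrite ler_pM2r// ge_min lexx.
have Vw : V w by exact: (admissible_closed hV Vu Hw cvg1 cvg2).
exists w; split=> //.
have [M aM] := admissible_bilin_bounded.
apply: (@squeeze_cvgr _ _ _ _ (fun=> 0)
  (fun m => alpha1 * \sum_i ip (part i (u m - w)) (part i (u m - w)) +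
            M * ip (u m - w).1 (u m - w).1)).
- near=> m; have Vd := admissibleB (Vu m) Vw.
  by rewrite admissible_bilin_ge0//= aM.
- exact: cvg_cst.
have c1 : (fun=> alpha1) @ \oo --> alpha1 by exact: cvg_cst.
have c2 : (fun=> M) @ \oo --> M by exact: cvg_cst.
have h := cvgD (cvgM c1 (cvg0_sum (index_enum 'I_n.+1) cvg2)) (cvgM c2 cvg1).
by rewrite !mulr0 addr0 in h; exact: h.
Unshelve. all: by end_near. Qed.

Lemma admissible0 u : V u -> V 0.
Proof. by move=> Vu; have := admissible_lin hV (-1) Vu Vu; rewrite scaleN1r addNr. Qed.

End energy_space.

Unset Implicit Arguments.

Theorem theorem5p1 (R : realType) (n : nat) (hn : (n.+1 <= 3)%N)
  (Om : set 'rV[R]_n.+1)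
  (Om_domain : is_domain Om) (Om_bounded : bounded_set Om)
  (Om_lipschitz : lipschitz_boundary Om)
  (alpha : 'rV[R]_n.+1 -> 'M[R]_n.+1) (alpha0 alpha1 : R)
  (alpha0_gt0 : 0 < alpha0) (alpha1_gt0 : 0 < alpha1)
  (halpha : diffusion_tensor Om alpha alpha0 alpha1)
  (q : 'rV[R]_n.+1 -> R) (hq : potential Om q)
  (V : set (@fgrad R n))
  (hV : V = H1 Om \/ exists2 GD, dirichlet_part Om GD & V = H1_D Om GD)
  (lam : nat -> R) (phi : nat -> @fgrad R n)
  (hlam : eigen_system Om V (bilin Om alpha q) lam phi)
  (c1 c2 : R) (c1_gt0 : 0 < c1) (c2_gt0 : 0 < c2)
  (M : nat) (Th : 'I_M -> 'I_n.+2 -> 'rV[R]_n.+1)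
  (hTh : triangulation Om Th)
  (h : R) (hh : h = mesh_size Th)
  (p : nat) (p_gt0 : (0 < p)%N)
  (Vh : set (@fgrad R n)) (hVh : fe_space V Th p Vh)
  (N : nat) (hN : has_dim Om Vh N)
  (Lh : @fgrad R n -> @fgrad R n)
  (hLh : discrete_operator Om (bilin Om alpha q) Vh Lh)
  (lamh : 'I_N -> R) (hlamh : operator_eigenvalues Om Vh Lh lamh)
  (Qh : @fgrad R n -> @fgrad R n) (hQh : L2_projection Om V Vh Qh)
  (Qh_stable : forall v, V v ->
     bilin Om alpha q (Qh v) (Qh v) <= c1 * bilin Om alpha q v v)
  (Qh_approx : forall v, V v ->
     l2 Om (v - Qh v) (v - Qh v) <= c2 * h ^+ 2 * bilin Om alpha q v v)
  (k : nat) (hk : lam k < 1 / (2 * c2 * h ^+ 2)) :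
  exists kN : (k < N)%N,
    0 <= Num.sqrt (lamh (Ordinal kN)) - Num.sqrt (lam k)
      <= (1 + c1 / 2) *
         sup [set Num.sqrt (bilin Om alpha q (w - Qh w) (w - Qh w)) |
              w in [set w | W phi k w /\ Num.sqrt (l2 Om w w) = 1]].
Proof.
have [_ Om_open _] := Om_domain.
have aV := admissible_boundary_conditions Om_open Om_bounded hV.
have [[lam0 lam_mono] Vphi phi_orth phi_eigen phi_complete] := hlam.
have lam_ge0 i : 0 <= lam i by apply: le_trans lam0 _; exact: lam_mono.
have V0 : V 0 := admissible0 aV (Vphi 0%N).
have closedV : submod_closed (fun u => `[<V u>]).
  split; first exact/asboolP.
  by move=> c u v /asboolP Vu /asboolP Vv; apply/asboolP; exact: (admissible_lin aV).
pose S := LinearSubspace closedV.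
pose F := subspace_of S.
pose a (u v : F) := bilin Om alpha q (subspace_val u) (subspace_val v).
pose b (u v : F) := l2 Om (subspace_val u) (subspace_val v).
have valV (u : F) : V (subspace_val u) := subspace_valP u.
have ha : semi_inner a.
  split=> [c u v w|u v|u].
  - by apply: (admissible_bilin_lin Om_open Om_bounded alpha0_gt0 halpha hq aV); exact: valV.
  - exact: (bilinC halpha).
  - by apply: (admissible_bilin_ge0 Om_open Om_bounded alpha0_gt0 halpha hq aV); exact: valV.
have hb : semi_inner b.
  split=> [c u v w|u v|u].
  - by apply: (admissible_l2_lin Om_open aV); exact: valV.
  - exact: ipC.
  - exact: ip_ge0.
have lift u : V u -> exists v : F, subspace_val v = u.
  by move=> Vu; exists (@to_subspace _ _ S u Vu).
have complete_ab : forall v : nat -> F,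
  (forall eps, 0 < eps -> exists m0, forall m l, (m0 <= m)%N -> (m0 <= l)%N ->
     a (v m - v l) (v m - v l) + b (v m - v l) (v m - v l) <= eps) ->
  exists u, (fun m => a (v m - u) (v m - u)) @ \oo --> 0 /\
            (fun m => b (v m - u) (v m - u)) @ \oo --> 0.
  move=> v hv.
  have [w [Vw cvga cvgb]] := admissible_complete Om_open Om_bounded alpha0_gt0 halpha hq aV
    (u := fun m => subspace_val (v m)) (fun m => valV (v m)) hv.
  by have [u uw] := lift w Vw; exists u; rewrite -uw in cvga cvgb.
pose phiF i : F := @to_subspace _ _ S (phi i) (Vphi i).
have phi_completeF mu u : (forall v : F, a u v = mu * b u v) ->
    exists (m : nat) (c : 'I_m -> R),
      (forall i : 'I_m, lam i != mu -> c i = 0) /\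
      b u u = \sum_(i < m) c i * b (phiF i) u.
  move=> hu; have [v Vv|m [c [hc ae]]] := phi_complete mu (subspace_val u) (valV u).
    by have [v' <-] := lift v Vv; exact: hu.
  exists m, c; split=> //.
  pose s := \sum_(i < m) c i *: phiF i.
  transitivity (b s u).
    have sE : subspace_val s = \sum_(i < m) c i *: phi i by rewrite subspace_val_sum.
    have [Lu _ _] := admissible_H1 aV (valV u).
    have [Ls _ _] := admissible_H1 aV (valV s).
    by rewrite /b -sE in ae *; exact: (ae_ip Om_open Lu Ls Lu ae).
  by rewrite (si_suml hb); apply: eq_bigr => i _; rewrite (siZl hb).
have [lamh_mono [psi [A [[VhE psi_free] LhA charA]]]] := hlamh.
have VhV : Vh `<=` V by have [] := hVh.
have psi_Vh i : Vh (psi i).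
  rewrite VhE; exists (fun j => (j == i)%:R); rewrite (bigD1 i)//= eqxx scale1r.
  by rewrite big1 ?addr0// => j /negbTE ->; rewrite scale0r.
pose psiF i : F := @to_subspace _ _ S (psi i) (VhV _ (psi_Vh i)).
have [e [e_orth e_energy e_span span_e]] :
    exists e : 'I_N -> F,
  [/\ forall i j, b (e i) (e j) = (i == j)%:R,
      forall i j, a (e i) (e j) = lamh i * (i == j)%:R,
      forall i, exists c, e i = \sum_j c j *: psiF j &
      forall c, \sum_j c j *: psiF j = \sum_i b (\sum_j c j *: psiF j) (e i) *: e i].
  (* Zero L2 norm means zero a.e., which is the sense in which [psi] is linearly independent. *)
  apply: (discrete_eigenbasis ha hb (A := A)) => [c c0|i j|//].
    apply: psi_free.
    have sE : subspace_val (\sum_i c i *: psiF i) = \sum_i c i *: psi i.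
      by rewrite subspace_val_sum.
    have [Ls _ _] := admissible_H1 aV (valV (\sum_i c i *: psiF i)).
    by rewrite -sE; exact: (ip0_ae Om_open Ls c0).
  have [VLh hL] := hLh _ (psi_Vh i).
  rewrite /a /= -(hL _ (psi_Vh j)) LhA.
  have -> : \sum_k0 A k0 i *: psi k0 = subspace_val (\sum_k0 A k0 i *: psiF k0).
    by rewrite subspace_val_sum.
  change (b (\sum_k0 A k0 i *: psiF k0) (psiF j) = \sum_k0 A k0 i * b (psiF k0) (psiF j)).
  by rewrite (si_suml hb); apply: eq_bigr => k0 _; rewrite (siZl hb).
have e_Vh i : Vh (subspace_val (e i)).
  by have [c ->] := e_span i; rewrite VhE; exists c; rewrite subspace_val_sum.
pose Q v := \sum_i b v (e i) *: e i.
(* An equality of vectors and not merely a.e.: Qh v lies in the span of [psi], where the expansion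
   in [e] is exact, and its coefficients are those of v by the projection property. *)
have QE (v : F) : subspace_val (Q v) = Qh (subspace_val v).
  have [VhQ hQ] := hQh _ (valV v).
  have := VhQ; rewrite VhE => -[c Qc].
  have Qc' : Qh (subspace_val v) = subspace_val (\sum_j c j *: psiF j).
    by rewrite subspace_val_sum.
  rewrite Qc' span_e; congr subspace_val; apply: eq_bigr => i _; congr (_ *: _).
  by rewrite /b -Qc' hQ.
pose K := c2 * h ^+ 2.
(* That h is nonzero is read off [hk]: for h = 0 its right side is 1 / 0 = 0, which cannot exceed
   the nonnegative [lam k]. *)
have K_gt0 : 0 < K.
  have := le_lt_trans (lam_ge0 k) hk; rewrite div1r invr_gt0 -mulrA.
  by rewrite pmulr_rgt0.
have Q_stable (v : F) : a (Q v) (Q v) <= c1 * a v v.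
  by rewrite /a QE; exact: Qh_stable.
have Q_approx (v : F) : b (v - Q v) (v - Q v) <= K * a v v.
  by rewrite /b subspace_valB QE; exact: Qh_approx.
have lamK : lam k * (2 * K) < 1.
  by move: hk; rewrite -mulrA -/K ltr_pdivlMr// mulr_gt0.
(* Pythagoras for [Q]: the squared coordinates give the norm of the projection, and the
   approximation property bounds the remainder. *)
have finite_rank (v : F) : b v v <= \sum_(i < N) b v (e i) ^+ 2 + K * a v v.
  rewrite (proj_pythagoras hb e_orth v) lerD//.
  by rewrite (orthonormal_norm hb e_orth).
have e_norm i : b (e i) (e i) <= 1 by rewrite e_orth eqxx.
have lamK1 : lam k * K < 1.
  by apply: le_lt_trans lamK; rewrite ler_wpM2l// mulr_natl mulr2n lerDl ltW.
have lower (v : F) : (forall i, (i < k)%N -> b v (phiF i) = 0) -> lam k * b v v <= a v v.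
  move=> Xv; apply: (spectral_lower_bound ha hb complete_ab lam_mono _ _ phi_completeF
    e_norm K_gt0 finite_rank lamK1 Xv).
  - by move=> i j; exact: phi_orth.
  - by move=> i v'; exact: phi_eigen.
have phi_orthF i j : b (phiF i) (phiF j) = (i == j)%:R := phi_orth i j.
have phi_eigenF i (v : F) : a (phiF i) v = lam i * b (phiF i) v := phi_eigen i _ (valV v).
have hlow := galerkin_lower ha hb lam_mono phi_orthF phi_eigenF e_orth e_energy lamh_mono
  K_gt0 Q_approx lamK lower.
have [c] := galerkin_upper ha hb lam_ge0 lam_mono phi_orthF phi_eigenF e_orth e_energy
  lamh_mono c1_gt0 K_gt0 Q_stable Q_approx lamK lower.
move=> p0; exists (galerkin_dim ha hb lam_mono phi_orthF phi_eigenF K_gt0 Q_approx lamK).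
move: hlow p0; set lk := lamh _ => hlow [w1 hupp].
rewrite subr_ge0 ler_sqrt ?(le_trans (lam_ge0 k) hlow)// hlow /= lerBlDl.
apply: le_trans hupp _; rewrite lerD2l ler_pM2l; last first.
  by rewrite ltr_pwDl// divr_ge0 ?ltW.
have defectE (v : F) : Num.sqrt (a (v - Q v) (v - Q v)) =
    Num.sqrt (bilin Om alpha q (subspace_val v - Qh (subspace_val v))
      (subspace_val v - Qh (subspace_val v))).
  by rewrite /a subspace_valB QE.
have sumE d : subspace_val (\sum_(i < k.+1) d i *: phiF i) = \sum_(i < k.+1) d i *: phi i.
  by rewrite subspace_val_sum.
apply: ub_le_sup.
  exists (Num.sqrt (lam k) + Num.sqrt (c1 * lam k)) => _ [_ [[d ->] d1] <-].
  rewrite -sumE -defectE.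
  apply: (galerkin_defect_bounded ha hb lam_ge0 lam_mono phi_orthF phi_eigenF c1_gt0 Q_stable).
  change (l2 Om (subspace_val (\sum_(i < k.+1) d i *: phiF i))
    (subspace_val (\sum_(i < k.+1) d i *: phiF i)) = 1).
  by rewrite sumE -[LHS]sqr_sqrtr ?d1 ?expr1n//; exact: ip_ge0.
exists (subspace_val (\sum_(i < k.+1) c i *: phiF i)); last by rewrite -defectE.
split; first by exists c; rewrite sumE.
by rewrite -[l2 _ _ _]/(b _ _) w1 sqrtr1.
Qed.
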